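(* Let $E,F$ be order complete vector lattices such that $E$ is atomless and $F$ is an order ideal of some Banach lattice with order continuous norm, and let $(V,E)$ be a Banach–Kantorovich space. Regard $F$ as a lattice-normed space $(F,F)$ with vector norm the modulus $|\cdot|$. Let $T:V\to F$ be a $(bo)$-continuous dominated linear operator, with exact dominant $\mathbf{T}:E\to F$. Then $T$ is order narrow if and only if $\mathbf{T}$ is order narrow.
   Context: Vector spaces are real and vector lattices are real and Archimedean. A lattice-normed space $(V,E)$ is a vector space $V$ with a vector lattice $E$ and a map $|\cdot|_V:V\to E$ (vector norm) such that $|v|_V\ge 0$, $|v|_V=0\iff v=0$, $|v_1+v_2|_V\le |v_1|_V+|v_2|_V$, $|\lambda v|_V=|\lambda||v|_V$ for $\lambda\in\mathbb R$. It is decomposable if whenever $x\in V$, $|x|_V=e_1+e_2$ with $e_1,e_2\in E_+$, there are $x_1,x_2\in V$ with $x=x_1+x_2$ and $|x_k|_V=e_k$ ($k=1,2$). Every vector lattice $E$ is itself a decomposable lattice-normed space $(E,E)$ with vector norm $|\cdot|$ (the modulus). A net $(v_\alpha)_{\alpha\in\Delta}$ in $V$ $(bo)$-converges to $v\in V$ if there is a decreasing net $(e_\gamma)_{\gamma\in\Gamma}$ in $E$ with $\inf_\gamma e_\gamma=0$ such that for every $\gamma$ there is $\alpha(\gamma)\in\Delta$ with $|v-v_\alpha|_V\le e_\gamma$ for all $\alpha\ge\alpha(\gamma)$. In $(E,E)$ this is order convergence. A net $(v_\alpha)$ is $(bo)$-fundamental if $(v_\alpha-v_\beta)_{(\alpha,\beta)\in\Delta\times\Delta}$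 $(bo)$-converges to $0$; $V$ is $(bo)$-complete if every $(bo)$-fundamental net $(bo)$-converges in $V$. A Banach–Kantorovich space is a decomposable $(bo)$-complete lattice-normed space. A linear operator between lattice-normed spaces is $(bo)$-continuous if $v_\alpha\to v$ in the $(bo)$-sense implies $Tv_\alpha\to Tv$ in the $(bo)$-sense. An atom of $E$ is an element $e>0$ such that $0\le f_1\le e$, $0\le f_2\le e$, $f_1\wedge f_2=0$ imply $f_1=0$ or $f_2=0$; $E$ is atomless if it has no atoms. Elements $x,y\in V$ are disjoint ($x\perp y$) if $|x|_V\wedge|y|_V=0$. An element $z\in V$ is a fragment of $x\in V$ if $|z|_V\le |x|_V$ and $z\perp(x-z)$. Two fragments $x_1,x_2$ of $x$ are mutually complemented ($MC$) if $x=x_1+x_2$. A linear operator $T:V\to W$ between lattice-normed spaces $(V,E)$, $(W,F)$ is order narrow if for every $u\in V$ there is a net $(v_\alpha)$ in $V$, each $v_\alpha$ being a difference $u_\alpha^1-u_\alpha^2$ of two $MC$ fragments of $u$, such that $Tv_\alpha$ $(bo)$-converges to $0$. For $\mathbf{T}:E\to F$ this is applied with $(V,E)=(E,E)$ and $(W,F)=(F,F)$. A linear operator $T:V\to W$ is dominated if there is a positive linear operator $S:E\to F$ (a dominant of $T$) with $|Tv|_W\le S|v|_V$ for all $v\in V$. When $V$ is decomposable and $F$ is order complete, every dominated $T$ has a least dominant (in the order of positive operators $E\to F$), called its exact dominant. *)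

(* Defs.v *)
From HB Require Import structures.
From mathcomp Require Import all_boot all_order all_algebra.
From mathcomp Require Import all_classical all_reals all_analysis.

Set Implicit Arguments.
Unset Strict Implicit.
Unset Printing Implicit Defensive.

Import Order.TTheory GRing.Theory Num.Theory.
Import numFieldNormedType.Exports.

Local Open Scope classical_set_scope.
Local Open Scope ring_scope.

(* The lattice operations are fields over [Num.POrderedZmodule] because
   Hierarchy Builder rejects a join of [Order.Lattice] and [GRing.Lmodule]
   (missing join with [Num.RealDomain]).  The last axiom makes every vector
   lattice Archimedean. *)
HB.mixin Record isVectorLattice (R : realType) E
    of GRing.Lmodule R E & Num.POrderedZmodule E := {
  vjoin : E -> E -> E ;
  vmeet : E -> E -> E ;
  vjoin_le : forall x y z : E, (vjoin x y <= z) = (x <= z) && (y <= z) ;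
  le_vmeet : forall x y z : E, (z <= vmeet x y) = (z <= x) && (z <= y) ;
  levD2r : forall z x y : E, x <= y -> x + z <= y + z ;
  levZ2l : forall (a : R) (x y : E), 0 <= a -> x <= y -> a *: x <= a *: y ;
  lev_archi : forall x y : E, 0 <= x -> (forall n : nat, x *+ n <= y) -> x = 0
}.

#[short(type="vectorLatticeType")]
HB.structure Definition VectorLattice (R : realType) :=
  { E of GRing.Lmodule R E & Num.POrderedZmodule E & isVectorLattice R E }.

Section VectorLatticeDefs.
Context (R : realType).
Implicit Types E F G : vectorLatticeType R.

Definition modulus E (x : E) : E := vjoin x (- x).

Definition order_complete E : Prop :=
  forall A : set E, A !=set0 -> has_ubound A -> supremums A !=set0.

Definition is_atom E (e : E) : Prop :=
  0 < e /\
  forall f1 f2 : E, 0 <= f1 -> f1 <= e -> 0 <= f2 -> f2 <= e ->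
    vmeet f1 f2 = 0 -> f1 = 0 \/ f2 = 0.

Definition atomless E : Prop := forall e : E, ~ is_atom e.

Definition order_ideal G (A : set G) : Prop :=
  [/\ A 0,
      forall (a : R) (x y : G), A x -> A y -> A (a *: x + y)
    & forall x y : G, modulus y <= modulus x -> A x -> A y].

Definition positive_operator E F (S : E -> F) : Prop :=
  forall e : E, 0 <= e -> 0 <= S e.

End VectorLatticeDefs.

Section LatticeNorm.
Context (R : realType).

Record latticeNorm (V : lmodType R) (E : vectorLatticeType R) := LatticeNorm {
  vnorm :> V -> E ;
  vnorm_ge0 : forall v, 0 <= vnorm v ;
  vnorm_eq0 : forall v, vnorm v = 0 <-> v = 0 ;
  vnormD : forall v1 v2, vnorm (v1 + v2) <= vnorm v1 + vnorm v2 ;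
  vnormZ : forall (a : R) v, vnorm (a *: v) = `|a| *: vnorm v }.

Variable E : vectorLatticeType R.
Implicit Types x y z : E.

Lemma levN x y : x <= y -> - y <= - x.
Proof.
move=> /(levD2r (- x - y)); rewrite addrA subrr add0r.
by rewrite [- x - y]addrC addrA subrr add0r.
Qed.

Lemma levD x y z t : x <= y -> z <= t -> x + z <= y + t.
Proof.
move=> xy zt; have h := levD2r z _ _ xy; apply: (le_trans h).
by rewrite ![y + _]addrC; exact: levD2r.
Qed.

Lemma le_vjoinl x y : x <= vjoin x y.
Proof. by have := lexx (vjoin x y); rewrite vjoin_le => /andP[]. Qed.

Lemma le_vjoinr x y : y <= vjoin x y.
Proof. by have := lexx (vjoin x y); rewrite vjoin_le => /andP[]. Qed.

Lemma modulus_ge0 x : 0 <= modulus x.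
Proof.
have h : 0 <= (2 : R) *: modulus x.
  rewrite scaler_nat mulr2n -[X in X <= _](subrr x).
  exact: levD (le_vjoinl _ _) (le_vjoinr _ _).
have := levZ2l (2^-1 : R) _ _ _ h.
by rewrite scaler0 scalerA mulVf ?pnatr_eq0// scale1r; apply; rewrite invr_ge0.
Qed.

Lemma modulus_eq0 x : modulus x = 0 <-> x = 0.
Proof.
split=> [x0|->]; last first.
  by apply/le_anti; rewrite modulus_ge0 andbT vjoin_le oppr0 lexx.
apply/le_anti; rewrite -{1}x0 le_vjoinl /=.
by rewrite -[x]opprK -[X in X <= _]oppr0; apply: levN; rewrite -x0 le_vjoinr.
Qed.

Lemma modulusD x y : modulus (x + y) <= modulus x + modulus y.
Proof.
by rewrite vjoin_le opprD !levD ?le_vjoinl ?le_vjoinr.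
Qed.

Lemma modulusZ (a : R) x : modulus (a *: x) = `|a| *: modulus x.
Proof.
have le_mod b z : modulus (b *: z) <= `|b| *: modulus z.
  rewrite vjoin_le -scaleNr; case: (ger0P b) => b0; apply/andP; split.
  - by apply: levZ2l => //; exact: le_vjoinl.
  - by rewrite scaleNr -scalerN; apply: levZ2l => //; exact: le_vjoinr.
  - rewrite -[b in X in X <= _]opprK scaleNr -scalerN.
    by apply: levZ2l; [rewrite oppr_ge0 ltW|exact: le_vjoinr].
  - by apply: levZ2l; [rewrite oppr_ge0 ltW|exact: le_vjoinl].
apply/le_anti; rewrite le_mod /=.
have [->|a0] := eqVneq a 0.
  by rewrite normr0 !scale0r; exact: modulus_ge0.
have := le_mod a^-1 (a *: x); rewrite scalerA mulVf// scale1r.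
move=> /(levZ2l _ _ _ (normr_ge0 a)).
by rewrite scalerA -normrM divff// normr1 scale1r.
Qed.

Definition modulus_norm : latticeNorm E E :=
  LatticeNorm modulus_ge0 modulus_eq0 modulusD modulusZ.

End LatticeNorm.

(* Hierarchy Builder also rejects a join of [VectorLattice] with
   [NormedModule], so the complete lattice norm of a Banach lattice is a
   record over a vector lattice. *)
Record banachLatticeNorm (R : realType) (G : vectorLatticeType R) :=
  BanachLatticeNorm {
    bnorm :> G -> R ;
    bnorm0_eq0 : forall x, bnorm x = 0 -> x = 0 ;
    bnormD : forall x y, bnorm (x + y) <= bnorm x + bnorm y ;
    bnormZ : forall (a : R) x, bnorm (a *: x) = `|a| * bnorm x ;
    bnorm_modulus : forall x y, modulus x <= modulus y -> bnorm x <= bnorm y ;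
    bnorm_complete : forall u : nat -> G,
      (forall eps : R, 0 < eps ->
         exists N : nat, forall m n : nat, (N <= m)%N -> (N <= n)%N ->
           bnorm (u m - u n) < eps) ->
      exists l : G, (fun n => bnorm (u n - l)) @ \oo --> (0 : R) }.

Record directedSet := DirectedSet {
  dcar :> Type ;
  dle : dcar -> dcar -> Prop ;
  dpoint : dcar ;
  dle_refl : forall a, dle a a ;
  dle_trans : forall a b c, dle a b -> dle b c -> dle a c ;
  dle_directed : forall a b, exists c, dle a c /\ dle b c }.

Section ProdDirected.
Variables A B : directedSet.

Definition prod_dle (p q : A * B) : Prop := dle p.1 q.1 /\ dle p.2 q.2.

Lemma prod_dle_refl p : prod_dle p p.
Proof. by split; exact: dle_refl. Qed.

Lemma prod_dle_trans p q r : prod_dle p q -> prod_dle q r -> prod_dle p r.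
Proof. by move=> [? ?] [? ?]; split; apply: dle_trans; eassumption. Qed.

Lemma prod_dle_directed p q : exists r, prod_dle p r /\ prod_dle q r.
Proof.
have [a [? ?]] := dle_directed p.1 q.1.
by have [b [? ?]] := dle_directed p.2 q.2; exists (a, b).
Qed.

Definition prod_directed : directedSet :=
  DirectedSet (dpoint A, dpoint B) prod_dle_refl prod_dle_trans
    prod_dle_directed.

End ProdDirected.

Section Nets.
Context (R : realType).

Definition decreasing_to0 (E : vectorLatticeType R) (D : directedSet)
    (e : D -> E) : Prop :=
  (forall a b : D, dle a b -> e b <= e a) /\ infimums (range e) 0.

Definition order_continuous_norm (G : vectorLatticeType R)
    (n : banachLatticeNorm G) : Prop :=
  forall (D : directedSet) (g : D -> G), decreasing_to0 g ->
  forall eps : R, 0 < eps -> exists a0 : D, forall a : D, dle a0 a ->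
    n (g a) < eps.

(* The range of [j] with the order of [G] is a copy of [F]. *)
Definition ideal_of_oc_banach_lattice (F : vectorLatticeType R) : Prop :=
  exists (G : vectorLatticeType R) (n : banachLatticeNorm G)
      (j : {linear F -> G}),
    [/\ order_continuous_norm n, {mono j : x y / x <= y}
      & order_ideal (range j)].

Definition bo_cvg (V : lmodType R) (E : vectorLatticeType R)
    (p : latticeNorm V E) (D : directedSet) (v : D -> V) (x : V) : Prop :=
  exists (C : directedSet) (e : C -> E), decreasing_to0 e /\
    forall c : C, exists a0 : D, forall a : D, dle a0 a -> p (x - v a) <= e c.

Definition bo_fundamental (V : lmodType R) (E : vectorLatticeType R)
    (p : latticeNorm V E) (D : directedSet) (v : D -> V) : Prop :=
  @bo_cvg V E p (prod_directed D D) (fun ab => v ab.1 - v ab.2) 0.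

Definition bo_complete (V : lmodType R) (E : vectorLatticeType R)
    (p : latticeNorm V E) : Prop :=
  forall (D : directedSet) (v : D -> V), bo_fundamental p v ->
  exists x : V, bo_cvg p v x.

Definition decomposable (V : lmodType R) (E : vectorLatticeType R)
    (p : latticeNorm V E) : Prop :=
  forall (x : V) (e1 e2 : E), 0 <= e1 -> 0 <= e2 -> p x = e1 + e2 ->
  exists x1 x2 : V, [/\ x = x1 + x2, p x1 = e1 & p x2 = e2].

Definition banach_kantorovich (V : lmodType R) (E : vectorLatticeType R)
    (p : latticeNorm V E) : Prop :=
  decomposable p /\ bo_complete p.

Definition disjoint_vec (V : lmodType R) (E : vectorLatticeType R)
    (p : latticeNorm V E) (x y : V) : Prop :=
  vmeet (p x) (p y) = 0.

Definition fragment (V : lmodType R) (E : vectorLatticeType R)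
    (p : latticeNorm V E) (z x : V) : Prop :=
  p z <= p x /\ disjoint_vec p z (x - z).

Definition mc_fragments (V : lmodType R) (E : vectorLatticeType R)
    (p : latticeNorm V E) (x x1 x2 : V) : Prop :=
  [/\ fragment p x1 x, fragment p x2 x & x = x1 + x2].

Section Operators.
Context (V W : lmodType R) (E F : vectorLatticeType R).
Variables (p : latticeNorm V E) (q : latticeNorm W F) (T : {linear V -> W}).

Definition bo_continuous : Prop :=
  forall (D : directedSet) (v : D -> V) (x : V),
    bo_cvg p v x -> bo_cvg q (fun a => T (v a)) (T x).

Definition order_narrow : Prop :=
  forall u : V, exists (D : directedSet) (v : D -> V),
    (forall a : D, exists u1 u2 : V,
       mc_fragments p u u1 u2 /\ v a = u1 - u2) /\
    bo_cvg q (fun a => T (v a)) 0.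

Definition is_dominant (S : {linear E -> F}) : Prop :=
  positive_operator S /\ forall v : V, q (T v) <= S (p v).

Definition dominated : Prop := exists S : {linear E -> F}, is_dominant S.

Definition is_exact_dominant (S : {linear E -> F}) : Prop :=
  is_dominant S /\
  forall S' : {linear E -> F}, is_dominant S' ->
    positive_operator (fun e => S' e - S e).

End Operators.

End Nets.

(* Main.v *)
(* Call a positive operator S : E -> F diffuse if every d >= 0 in E has finite
   disjoint partitions (d_i) such that all S d_i are below S d / 2 up to an
   error that is small for the order continuous functionals on F.  The theorem
   follows from the equivalence, for a decomposable lattice-normed space, of
   "T is order narrow" and "the exact dominant S of T is diffuse", applied to
   T and to S: a positive operator is its own exact dominant.

   If T is order narrow and U is a positive operator below S that preserves
   disjointness, splitting w into complementary fragments w1, w2 with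
   T w1 - T w2 small gives |T w| <= 2 (S - U)|w|; minimality of S yields
   2 U <= S, and by iteration U = 0.  Keeping, for each partition of d, only
   the part of S d_i lying over the band where S d_i > S d / 2, and taking the
   infimum over all partitions, produces such a U, so U = 0 and S is diffuse.

   Conversely, if S is diffuse then d = |u| can be split so finely that all
   |T u_i| are small compared with S|u| while their sum stays below S|u|.
   A greedy choice of signs for the potential phi (x^2 / S|u|), with phi an
   order continuous functional, then makes phi |sum +- T u_i| small.  Since F
   is an ideal of a Banach lattice with order continuous norm, an increasing
   sequence of such functionals is strictly positive on [0, S|u|], which turns
   this smallness into order convergence to 0. *)
From HB Require Import structures.
Require Import Defs.
From mathcomp Require Import all_boot all_order all_algebra.
From mathcomp Require Import all_classical all_reals all_analysis.
From mathcomp Require Import ring lra.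

Set Implicit Arguments.
Unset Strict Implicit.
Unset Printing Implicit Defensive.

Import Order.TTheory GRing.Theory Num.Theory.

Local Open Scope classical_set_scope.
Local Open Scope ring_scope.

(* Linear identities in a module are decided by comparing the coefficients
   of the atoms. *)
Section LinearReflection.
Context (R : realType) (V : lmodType R).

Inductive lexp :=
  | LVar of nat | LZero | LAdd of lexp & lexp | LOpp of lexp
  | LScale of R & lexp | LMuln of lexp & nat.

Fixpoint leval (s : seq V) (e : lexp) : V :=
  match e with
  | LVar n => nth 0 s n
  | LZero => 0
  | LAdd e1 e2 => leval s e1 + leval s e2
  | LOpp e1 => - leval s e1
  | LScale a e1 => a *: leval s e1
  | LMuln e1 n => leval s e1 *+ n
  end.

Fixpoint lcoef (e : lexp) (i : nat) : R :=
  match e with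
  | LVar n => if Nat.eqb n i then 1 else 0
  | LZero => 0
  | LAdd e1 e2 => lcoef e1 i + lcoef e2 i
  | LOpp e1 => - lcoef e1 i
  | LScale a e1 => a * lcoef e1 i
  | LMuln e1 n => lcoef e1 i *+ n
  end.

Fixpoint lcoef_eq (e1 e2 : lexp) (k : nat) : Prop :=
  match k with
  | O => True
  | S k => lcoef e1 k = lcoef e2 k /\ lcoef_eq e1 e2 k
  end.

(** A variable outside the list reads the default 0 of [nth], so only coefficients at indices below
    [size s] contribute. *)
Lemma levalE s e : leval s e = \sum_(i < size s) lcoef e i *: nth 0 s i.
Proof.
elim: e => /= [n||e1 -> e2 ->|e ->|a e ->|e -> n].
- have [ns|ns] := ltnP n (size s).
    rewrite (bigD1 (Ordinal ns)) //= PeanoNat.Nat.eqb_refl scale1r big1 ?addr0//.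
    move=> i; rewrite -val_eqE /= => ni.
    case: PeanoNat.Nat.eqb_spec => [nE|]; last by rewrite scale0r.
    by rewrite -nE eqxx in ni.
  rewrite nth_default// big1// => i _; case: PeanoNat.Nat.eqb_spec => [nE|].
    by have := ltn_ord i; rewrite -nE ltnNge ns.
  by rewrite scale0r.
- by rewrite big1// => i _; rewrite scale0r.
- by rewrite -big_split /=; apply: eq_bigr => i _; rewrite scalerDl.
- by rewrite -sumrN; apply: eq_bigr => i _; rewrite scaleNr.
- by rewrite scaler_sumr; apply: eq_bigr => i _; rewrite scalerA.
- by rewrite -sumrMnl; apply: eq_bigr => i _; rewrite scalerMnl.
Qed.

Lemma leval_eq s e1 e2 : lcoef_eq e1 e2 (size s) -> leval s e1 = leval s e2.
Proof.
move=> h; rewrite !levalE; apply: eq_bigr => i _; congr (_ *: _).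
elim: (size s) i h => [[]//|k IH] i /= [hk h].
have := ltn_ord i; rewrite ltnS leq_eqVlt => /orP[/eqP ->//|ik].
exact: (IH (Ordinal ik)).
Qed.

End LinearReflection.

(* Atoms are compared up to unification since the same operation can be reached
   through several inheritance paths. *)
Ltac lin_index x s :=
  lazymatch s with
  | cons ?y ?s' =>
    match constr:(Set) with
    | _ => let _ := match constr:(Set) with _ => unify x y end in constr:(O)
    | _ => let n := lin_index x s' in constr:(S n)
    end
  end.

Ltac lin_rcons s x :=
  lazymatch s with
  | nil => constr:(cons x nil)
  | cons ?y ?s' => let r := lin_rcons s' x in constr:(cons y r)
  end.

Ltac lin_add x s :=
  match constr:(Set) with
  | _ => let _ := lin_index x s in s
  | _ => lin_rcons s x
  end.

Ltac lin_atoms t s :=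
  lazymatch t with
  | ?a + ?b => let s1 := lin_atoms a s in lin_atoms b s1
  | - ?a => lin_atoms a s
  | _ *: ?a => lin_atoms a s
  | ?a *+ _ => lin_atoms a s
  | 0 => s
  | ?x => lin_add x s
  end.

Ltac lin_quote R t s :=
  lazymatch t with
  | ?a + ?b => let e1 := lin_quote R a s in let e2 := lin_quote R b s in
               constr:(@LAdd R e1 e2)
  | - ?a => let e1 := lin_quote R a s in constr:(@LOpp R e1)
  | ?c *: ?a => let e1 := lin_quote R a s in constr:(@LScale R c e1)
  | ?a *+ ?n => let e1 := lin_quote R a s in constr:(@LMuln R e1 n)
  | 0 => constr:(@LZero R)
  | ?x => let n := lin_index x s in constr:(@LVar R n)
  end.

Ltac linmod R V :=
  lazymatch goal with
  | |- ?a = ?b =>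
    let s1 := lin_atoms a (@nil V) in
    let s := lin_atoms b s1 in
    let e1 := lin_quote R a s in
    let e2 := lin_quote R b s in
    refine (@leval_eq R V s e1 e2 _);
    cbn [lcoef_eq size lcoef Nat.eqb];
    repeat (split; [solve [ring | lra | field; assumption]|]); exact I
  end.

Section OrderTheory.
Context (R : realType) (E : vectorLatticeType R).
Implicit Types x y z a b c d : E.

Lemma lev_diff a b x y : a <= b -> y - x = b - a -> x <= y.
Proof.
move=> /(levD2r (- a)); rewrite subrr => ab xy.
by move: ab; rewrite -xy => /(levD2r x); rewrite add0r subrK.
Qed.

End OrderTheory.

(* Proves [x <= y] from [h : a <= b] when [y - x] and [b - a] agree as linear
   combinations. *)
Ltac linle h :=
  match goal with
  | E : vectorLatticeType ?R |- _ =>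
    apply: (@lev_diff R E _ _ _ _ h); linmod R E
  end.

Ltac lineq :=
  match goal with
  | E : vectorLatticeType ?R |- _ => linmod R E
  | E : lmodType ?R |- _ => linmod R E
  end.

(** * Elementary vector lattice calculus: disjointness, positive parts, modulus *)

Section VectorLatticeTheory.
Context (R : realType) (E : vectorLatticeType R).
Implicit Types x y z w a b c d : E.

Lemma levB_ge0 x y : (0 <= y - x) = (x <= y).
Proof. by apply/idP/idP => h; linle h. Qed.

Lemma levMn x y n : x <= y -> x *+ n <= y *+ n.
Proof. by move=> xy; elim: n => [|n IH]; rewrite ?mulr0n// !mulrS levD. Qed.

Lemma levMn_ge0 x n : 0 <= x -> 0 <= x *+ n.
Proof. by move=> /(levMn n); rewrite mul0rn. Qed.

Lemma levMnr x m n : 0 <= x -> (m <= n)%N -> x *+ m <= x *+ n.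
Proof.
move=> x0 /subnK <-; rewrite mulrnDr.
by have := levMn_ge0 (n - m) x0 => h; linle h.
Qed.

Lemma levZ_ge0 (t : R) x : 0 <= t -> 0 <= x -> 0 <= t *: x.
Proof. by move=> t0 /(levZ2l t _ _ t0); rewrite scaler0. Qed.

Lemma levZ2r (s t : R) x : s <= t -> 0 <= x -> s *: x <= t *: x.
Proof.
move=> st x0; have h : 0 <= (t - s) *: x by rewrite levZ_ge0// subr_ge0.
by linle h.
Qed.

Lemma levD_ge0 x y : 0 <= x -> 0 <= y -> 0 <= x + y.
Proof. by move=> x0 y0; have := levD x0 y0; rewrite addr0. Qed.

Lemma lev_addr x y : 0 <= y -> x <= x + y.
Proof. by move=> h; linle h. Qed.

Lemma lev_addl x y : 0 <= y -> x <= y + x.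
Proof. by move=> h; linle h. Qed.

Lemma lev_sum_ge0 (I : Type) (s : seq I) (P : pred I) (f : I -> E) :
  (forall i, P i -> 0 <= f i) -> 0 <= \sum_(i <- s | P i) f i.
Proof. by move=> h; elim/big_rec: _ => // i x Pi; apply: levD_ge0; exact: h. Qed.

Lemma lev_sum (I : eqType) (s : seq I) (f g : I -> E) :
  (forall i, i \in s -> f i <= g i) -> \sum_(i <- s) f i <= \sum_(i <- s) g i.
Proof.
elim: s => [|i s IH] h; first by rewrite !big_nil.
rewrite !big_cons levD ?h ?mem_head// IH// => j js.
by rewrite h// in_cons js orbT.
Qed.

Lemma vmeet_lel x y : vmeet x y <= x.
Proof. by have := lexx (vmeet x y); rewrite le_vmeet => /andP[]. Qed.

Lemma vmeet_ler x y : vmeet x y <= y.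
Proof. by have := lexx (vmeet x y); rewrite le_vmeet => /andP[]. Qed.

Lemma vmeetC x y : vmeet x y = vmeet y x.
Proof. by apply/le_anti; rewrite !le_vmeet !vmeet_lel !vmeet_ler. Qed.

Lemma vjoinC x y : vjoin x y = vjoin y x.
Proof. by apply/le_anti; rewrite !vjoin_le !le_vjoinl !le_vjoinr. Qed.

Lemma lev_meet2 x y z w : x <= y -> z <= w -> vmeet x z <= vmeet y w.
Proof.
move=> xy zw; rewrite le_vmeet (le_trans (vmeet_lel _ _) xy).
exact: le_trans (vmeet_ler _ _) zw.
Qed.

Lemma lev_join2 x y z w : x <= y -> z <= w -> vjoin x z <= vjoin y w.
Proof.
move=> xy zw; rewrite vjoin_le (le_trans xy (le_vjoinl _ _)).
exact: le_trans zw (le_vjoinr _ _).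
Qed.

Lemma vmeet_ge0 x y : 0 <= x -> 0 <= y -> 0 <= vmeet x y.
Proof. by move=> x0 y0; rewrite le_vmeet x0. Qed.

Lemma vmeet_l x y : x <= y -> vmeet x y = x.
Proof. by move=> xy; apply/le_anti; rewrite vmeet_lel le_vmeet lexx. Qed.

Lemma vjoin_l x y : y <= x -> vjoin x y = x.
Proof. by move=> xy; apply/le_anti; rewrite le_vjoinl vjoin_le lexx xy. Qed.

(** The map z |-> x + y - z reverses the order and exchanges x and y, hence turns upper bounds of
    the pair into lower bounds and back. *)
Lemma vjoinDvmeet x y : vjoin x y + vmeet x y = x + y.
Proof.
apply/le_anti/andP; split.
  suff h : vjoin x y <= x + y - vmeet x y by linle h.
  rewrite vjoin_le; apply/andP; split.
    by have h := vmeet_ler x y; linle h.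
  by have h := vmeet_lel x y; linle h.
suff h : x + y - vjoin x y <= vmeet x y by linle h.
rewrite le_vmeet; apply/andP; split.
  by have h := le_vjoinr x y; linle h.
by have h := le_vjoinl x y; linle h.
Qed.

Lemma disj_addE x y : vmeet x y = 0 -> x + y = vjoin x y.
Proof. by move=> xy; rewrite -vjoinDvmeet xy addr0. Qed.

Lemma disj_addle x y z : vmeet x y = 0 -> x <= z -> y <= z -> x + y <= z.
Proof. by move=> /disj_addE -> xz yz; rewrite vjoin_le xz. Qed.

Lemma disj_le x x' y y' : 0 <= x -> 0 <= y -> x <= x' -> y <= y' ->
  vmeet x' y' = 0 -> vmeet x y = 0.
Proof.
move=> x0 y0 xx' yy' d; apply/le_anti; rewrite vmeet_ge0// andbT -d.
exact: lev_meet2.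
Qed.

Lemma vmeet_disj0 x y : 0 <= x -> 0 <= y -> vmeet x y <= 0 -> vmeet x y = 0.
Proof. by move=> x0 y0 h; apply/le_anti; rewrite h vmeet_ge0. Qed.

Lemma vmeetDl_le x y z : 0 <= x -> 0 <= y -> 0 <= z ->
  vmeet (x + y) z <= vmeet x z + vmeet y z.
Proof.
move=> x0 y0 z0; set w := vmeet (x + y) z.
have wxy : w <= x + y := vmeet_lel _ _.
have wz : w <= z := vmeet_ler _ _.
suff h : w - vmeet y z <= vmeet x z by linle h.
rewrite le_vmeet; apply/andP; split; last first.
  by have h := levD wz (vmeet_ge0 y0 z0); linle h.
suff h : w - x <= vmeet y z by linle h.
rewrite le_vmeet; apply/andP; split; first by linle wxy.
by have h := levD wz x0; linle h.
Qed.

Lemma disjD x y z : 0 <= x -> 0 <= y -> 0 <= z ->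
  vmeet x z = 0 -> vmeet y z = 0 -> vmeet (x + y) z = 0.
Proof.
move=> x0 y0 z0 xz yz; apply: vmeet_disj0 => //; first exact: levD_ge0.
by apply: (le_trans (vmeetDl_le x0 y0 z0)); rewrite xz yz addr0.
Qed.

Lemma disjMn x y n m : 0 <= x -> 0 <= y -> vmeet x y = 0 ->
  vmeet (x *+ n) (y *+ m) = 0.
Proof.
move=> x0 y0 xy.
have base z k : 0 <= z -> vmeet x z = 0 -> vmeet (x *+ k) z = 0.
  move=> z0 xz; elim: k => [|k IH]; first by rewrite mulr0n vmeet_l.
  by rewrite mulrS disjD// levMn_ge0.
apply: base; first exact: levMn_ge0.
elim: m => [|m IH]; first by rewrite mulr0n vmeetC vmeet_l.
by rewrite mulrS vmeetC disjD ?levMn_ge0// 1?vmeetC.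
Qed.

(** The meets with x and y are again disjoint, so their sum is their join, and each of them is below
    the left side. *)
Lemma vmeetD_disj a x y : 0 <= a -> 0 <= x -> 0 <= y -> vmeet x y = 0 ->
  vmeet a (x + y) = vmeet a x + vmeet a y.
Proof.
move=> a0 x0 y0 xy; apply/le_anti/andP; split.
  by rewrite !(vmeetC a) vmeetDl_le.
apply: disj_addle; [|by apply: lev_meet2 => //; exact: lev_addr
  |by apply: lev_meet2 => //; exact: lev_addl].
by apply: disj_le xy; rewrite ?vmeet_ge0 ?vmeet_ler.
Qed.

Definition vpos x : E := vjoin x 0.

Lemma vpos_ge0 x : 0 <= vpos x. Proof. exact: le_vjoinr. Qed.

Lemma le_vpos x : x <= vpos x. Proof. exact: le_vjoinl. Qed.

Lemma vpos_le x y : (vpos x <= y) = (x <= y) && (0 <= y).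
Proof. exact: vjoin_le. Qed.

Lemma vpos_id x : 0 <= x -> vpos x = x.
Proof. by move=> x0; rewrite /vpos vjoin_l. Qed.

Lemma vposB x : vpos x - vpos (- x) = x.
Proof.
suff -> : vpos (- x) = - vmeet x 0 by rewrite opprK vjoinDvmeet addr0.
apply/le_anti/andP; split.
  rewrite vpos_le; apply/andP; split; first exact: levN (vmeet_lel _ _).
  by have h := vmeet_ler x 0; linle h.
have h1 := le_vpos (- x); have h2 := vpos_ge0 (- x).
suff h : - vpos (- x) <= vmeet x 0 by linle h.
by rewrite le_vmeet; apply/andP; split; [linle h1|linle h2].
Qed.

Lemma vpos_disj x : vmeet (vpos x) (vpos (- x)) = 0.
Proof.
apply: vmeet_disj0; rewrite ?vpos_ge0//.
set n := vpos (- x).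
have xE : vpos x = x + n by rewrite -[x in x + n]vposB subrK.
have nE : - n = vmeet x 0.
  have : vpos x + vmeet x 0 = x by rewrite vjoinDvmeet addr0.
  by rewrite xE => /(canRL (addKr _)) ->; lineq.
suff h : vmeet (vpos x) n - n <= vmeet x 0 by rewrite -nE in h; linle h.
rewrite le_vmeet; apply/andP; split.
  by have h := vmeet_lel (vpos x) n; rewrite {2}xE in h; linle h.
by have h := vmeet_ler (vpos x) n; linle h.
Qed.

Lemma modulusE x : modulus x = vpos x + vpos (- x).
Proof.
apply/le_anti/andP; split.
  rewrite vjoin_le; apply/andP; split.
    by have h := levD (le_vpos x) (vpos_ge0 (- x)); linle h.
  by have h := levD (le_vpos (- x)) (vpos_ge0 x); linle h.
apply: disj_addle; first exact: vpos_disj.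
  by rewrite vpos_le le_vjoinl modulus_ge0.
by rewrite vpos_le le_vjoinr modulus_ge0.
Qed.

Lemma modulus_le x y : (modulus x <= y) = (x <= y) && (- x <= y).
Proof. exact: vjoin_le. Qed.

Lemma le_modulus x : x <= modulus x. Proof. exact: le_vjoinl. Qed.

Lemma leN_modulus x : - x <= modulus x. Proof. exact: le_vjoinr. Qed.

Lemma modulusN x : modulus (- x) = modulus x.
Proof. by rewrite /modulus opprK vjoinC. Qed.

Lemma modulus_id x : 0 <= x -> modulus x = x.
Proof.
by move=> x0; apply: vjoin_l; apply: (le_trans _ x0); linle x0.
Qed.

End VectorLatticeTheory.

(** * Suprema and infima of bounded sets in an order complete lattice *)

Section Suprema.
Context (R : realType) (E : vectorLatticeType R).
Implicit Types (A : set E) (x m : E).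

Definition vsup A : E := xget 0 (supremums A).
Definition vinf A : E := vsup (lbound A).

Context (ocE : order_complete E).

Lemma vsupP A x m : A x -> ubound A m -> supremums A (vsup A).
Proof.
move=> Ax Am; have [s sA] : supremums A !=set0.
  by apply: ocE; [exists x|exists m].
exact: (xgetPex 0 (ex_intro _ s sA)).
Qed.

Lemma vsup_ge A x m : ubound A m -> A x -> x <= vsup A.
Proof. by move=> Am Ax; have [+ _] := vsupP Ax Am; apply. Qed.

Lemma vsup_le A x m : A x -> ubound A m -> vsup A <= m.
Proof. by move=> Ax Am; have [_] := vsupP Ax Am; apply. Qed.

Lemma vinf_le A x m : lbound A m -> A x -> vinf A <= x.
Proof. by move=> Am Ax; apply: (vsup_le Am) => z; apply. Qed.

Lemma vinf_ge A x m : A x -> lbound A m -> m <= vinf A.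
Proof. by move=> Ax Am; apply: (@vsup_ge _ _ x) => // z; apply. Qed.

End Suprema.

(** * Band projections *)

Section Band.
Context (R : realType) (E : vectorLatticeType R).
Implicit Types b x y z : E.

(* For [0 <= b, x] this is the projection of [x] onto the band generated by
   [b]. *)
Definition band b x : E := vsup (range (fun n => vmeet x (b *+ n))).

Context (ocE : order_complete E).

Lemma band_ge b x n : vmeet x (b *+ n) <= band b x.
Proof.
apply: (vsup_ge ocE (m := x)); last by exists n.
by move=> _ [k _ <-]; exact: vmeet_lel.
Qed.

Lemma band_min b x z : (forall n, vmeet x (b *+ n) <= z) -> band b x <= z.
Proof.
move=> h; apply: (vsup_le ocE (x := vmeet x (b *+ 0))); first by exists 0%N.
by move=> _ [k _ <-].
Qed.

Lemma band_min2 b b' x x' z :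
  (forall n m, vmeet x (b *+ n) + vmeet x' (b' *+ m) <= z) ->
  band b x + band b' x' <= z.
Proof.
move=> h; suff h1 : band b x <= z - band b' x' by linle h1.
apply: band_min => n.
suff h1 : band b' x' <= z - vmeet x (b *+ n) by linle h1.
by apply: band_min => m; have h1 := h n m; linle h1.
Qed.

Lemma band_le b x : band b x <= x.
Proof. by apply: band_min => n; exact: vmeet_lel. Qed.

Lemma band_ge0 b x : 0 <= x -> 0 <= band b x.
Proof. by move=> x0; apply: le_trans (band_ge b x 0); rewrite vmeet_ge0. Qed.

Lemma band_meet b x : vmeet x b <= band b x.
Proof. exact: (band_ge b x 1). Qed.

Lemma band_mono b b' x x' : b <= b' -> x <= x' -> band b x <= band b' x'.
Proof.
move=> bb' xx'; apply: band_min => n; apply: le_trans (band_ge _ _ n).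
by apply: lev_meet2 => //; exact: levMn.
Qed.

Lemma bandD b x y : 0 <= b -> 0 <= x -> 0 <= y ->
  band b (x + y) = band b x + band b y.
Proof.
move=> b0 x0 y0; apply/le_anti/andP; split.
  apply: band_min => n; apply: le_trans (vmeetDl_le x0 y0 (levMn_ge0 n b0)) _.
  by rewrite levD// band_ge.
apply: band_min2 => n m; apply: le_trans (band_ge _ _ (n + m)).
by rewrite le_vmeet !mulrnDr !levD ?vmeet_lel ?vmeet_ler.
Qed.

(** The meet w of the projection with y is disjoint from every approximant [vmeet x (b *+ n)], so
    approximant plus w is a join and stays below the projection. Thus the projection minus w is
    still an upper bound, which forces w <= 0. *)
Lemma band_disj b x y : 0 <= b -> 0 <= x -> 0 <= y -> vmeet b y = 0 ->
  vmeet (band b x) y = 0.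
Proof.
move=> b0 x0 y0 by0; apply: vmeet_disj0 => //; first exact: band_ge0.
set w := vmeet _ y; suff h : band b x <= band b x - w by linle h.
apply: band_min => n.
suff h : vmeet x (b *+ n) + w <= band b x by linle h.
apply: disj_addle (band_ge _ _ _) (vmeet_lel _ _).
apply: (disj_le _ _ (vmeet_ler _ _) (vmeet_ler _ _) (disjMn n 1 b0 y0 by0)).
  by rewrite vmeet_ge0 ?levMn_ge0.
by rewrite vmeet_ge0 ?band_ge0.
Qed.

Lemma band_disj2 b b' x x' : 0 <= b -> 0 <= b' -> 0 <= x -> 0 <= x' ->
  vmeet b b' = 0 -> vmeet (band b x) (band b' x') = 0.
Proof.
move=> b0 b'0 x0 x'0 bb'; apply: band_disj => //; first exact: band_ge0.
by rewrite vmeetC; apply: band_disj => //; rewrite vmeetC.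
Qed.

Lemma band_eq0 b x : 0 <= b -> 0 <= x -> vmeet x b = 0 -> band b x = 0.
Proof.
move=> b0 x0 xb; apply/le_anti; rewrite band_ge0// andbT.
by apply: band_min => n; rewrite -[x]mulr1n disjMn.
Qed.

Lemma bandD_disj b b' x : 0 <= b -> 0 <= b' -> 0 <= x -> vmeet b b' = 0 ->
  band b x + band b' x <= band (b + b') x.
Proof.
move=> b0 b'0 x0 bb'; apply: band_min2 => n m.
apply: le_trans (band_ge _ _ (n + m)); apply: disj_addle.
- apply: (disj_le _ _ (vmeet_ler _ _) (vmeet_ler _ _) (disjMn n m b0 b'0 bb'));
  by rewrite vmeet_ge0 ?levMn_ge0.
- apply: lev_meet2 => //; rewrite mulrnDl mulrnDr -addrA lev_addr//.
  by rewrite levD_ge0 ?levMn_ge0 ?levD_ge0.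
- apply: lev_meet2 => //; rewrite mulrnDl !mulrnDr addrA lev_addl//.
  by rewrite !levD_ge0 ?levMn_ge0.
Qed.

(** Adding w to the n-th approximant gives an element below the next one, so again the projection
    minus w bounds all approximants. *)
Lemma band_compl b x : 0 <= b -> 0 <= x ->
  vmeet (x - band b x) b = 0 /\ vmeet (band b x) (x - band b x) = 0.
Proof.
move=> b0 x0; have d0 : 0 <= x - band b x by rewrite levB_ge0 band_le.
have h : vmeet (x - band b x) b = 0.
  apply: vmeet_disj0 => //; set w := vmeet _ b.
  suff h : band b x <= band b x - w by linle h.
  apply: band_min => n; suff h : vmeet x (b *+ n) + w <= band b x by linle h.
  apply: le_trans (band_ge _ _ n.+1); rewrite le_vmeet; apply/andP; split.
    have h := levD (band_ge b x n) (vmeet_lel (x - band b x) b).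
    by rewrite -/w in h; linle h.
  by rewrite mulrSr levD ?vmeet_ler.
by split => //; apply: band_disj => //; rewrite vmeetC.
Qed.

End Band.

(** * Extension of positive additive maps from the positive cone *)

Section LinearExtension.
Context (R : realType) (E F : vectorLatticeType R) (u : E -> F).
Context (u_ge0 : forall x, 0 <= x -> 0 <= u x).
Context (uD : forall x y, 0 <= x -> 0 <= y -> u (x + y) = u x + u y).

Let u_mono x y : 0 <= x -> x <= y -> u x <= u y.
Proof.
move=> x0 xy; have d0 : 0 <= y - x by rewrite levB_ge0.
by rewrite -(subrK x y) uD// lev_addl// u_ge0.
Qed.

Let uMn x n : 0 <= x -> u (x *+ n) = u x *+ n.
Proof.
move=> x0; elim: n => [|n IH].
  rewrite !mulr0n; have := uD (lexx 0) (lexx 0).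
  by rewrite addr0 -[LHS]addr0 => /addrI/esym.
by rewrite !mulrS uD ?levMn_ge0// IH.
Qed.

(** With k the integer part of a n, both n u(a x) and n a u(x) lie between k u(x) and (k + 1) u(x).
    Hence n times the modulus of their difference over n stays below u(x), and the Archimedean axiom
    applies. *)
Let uZ (a : R) x : 0 <= a -> 0 <= x -> u (a *: x) = a *: u x.
Proof.
move=> a0 x0; have ax0 : 0 <= a *: x by exact: levZ_ge0.
apply/subr0_eq/modulus_eq0/(@lev_archi _ _ _ (u x)).
  exact: modulus_ge0.
move=> n; have na0 : 0 <= a * n%:R by rewrite mulr_ge0.
have /andP[k1 k2] := truncn_itv na0; set k := Num.truncn _ in k1 k2.
have lo : u x *+ k <= u (a *: x) *+ n.
  rewrite -!uMn//; apply: u_mono; first exact: levMn_ge0.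
  rewrite -[x *+ k]scaler_nat -[X in _ <= X]scaler_nat scalerA mulrC.
  exact: levZ2r.
have hi : u (a *: x) *+ n <= u x *+ k.+1.
  rewrite -!uMn//; apply: u_mono; first exact: levMn_ge0.
  rewrite -[x *+ _]scaler_nat -[X in X <= _]scaler_nat scalerA mulrC.
  exact/levZ2r/x0/ltW.
have lo' : u x *+ k <= (a *: u x) *+ n.
  rewrite -[u x *+ k]scaler_nat -[X in _ <= X]scaler_nat scalerA mulrC.
  exact/levZ2r/u_ge0.
have hi' : (a *: u x) *+ n <= u x *+ k.+1.
  rewrite -[u x *+ _]scaler_nat -[X in X <= _]scaler_nat scalerA mulrC.
  exact/levZ2r/u_ge0/x0/ltW.
have -> : modulus (u (a *: x) - a *: u x) *+ n =
    modulus (u (a *: x) *+ n - (a *: u x) *+ n).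
  by rewrite -mulrnBl -[in RHS]scaler_nat modulusZ normr_nat scaler_nat.
rewrite mulrS in hi hi'.
rewrite modulus_le; apply/andP; split.
  by have h := levD hi (levN lo'); linle h.
by have h := levD hi' (levN lo); linle h.
Qed.

Let v x := u (vpos x) - u (vpos (- x)).

(** Independence of the decomposition: linearity of [v] then follows by picking a convenient
    difference of positive elements in each case. *)
Let vE x y z : 0 <= y -> 0 <= z -> x = y - z -> v x = u y - u z.
Proof.
move=> y0 z0 xE; have p0 := vpos_ge0 x; have n0 := vpos_ge0 (- x).
have : u (vpos x + z) = u (vpos (- x) + y).
  congr u; apply/subr0_eq.
  transitivity ((vpos x - vpos (- x)) - (y - z)); first by lineq.
  by rewrite vposB -xE subrr.
rewrite !uD// => h; rewrite /v.
by rewrite -[u (vpos x)](addrK (u z)) h; lineq.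
Qed.

Let v_linear : linear v.
Proof.
have vD x y : v (x + y) = v x + v y.
  rewrite (@vE _ (vpos x + vpos y) (vpos (- x) + vpos (- y))).
  - by rewrite !uD ?vpos_ge0// /v; lineq.
  - by rewrite levD_ge0 ?vpos_ge0.
  - by rewrite levD_ge0 ?vpos_ge0.
  - by rewrite -[x in LHS]vposB -[y in LHS]vposB; lineq.
have vN x : v (- x) = - v x by rewrite /v opprK opprB.
have vZ a x : 0 <= a -> v (a *: x) = a *: v x.
  move=> a0; rewrite (@vE _ (a *: vpos x) (a *: vpos (- x))).
  - by rewrite !uZ ?vpos_ge0// /v scalerBr.
  - by rewrite levZ_ge0 ?vpos_ge0.
  - by rewrite levZ_ge0 ?vpos_ge0.
  - by rewrite -scalerBr vposB.
move=> a x y; rewrite vD; congr (_ + _).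
have [a0|a0] := leP 0 a; first exact: vZ.
have na0 : 0 <= - a by rewrite oppr_ge0 ltW.
by rewrite -[a in LHS]opprK scaleNr vN vZ// scaleNr opprK.
Qed.

Lemma Kantorovich_extension :
  exists L : {linear E -> F}, forall x, 0 <= x -> L x = u x.
Proof.
pose L : {linear E -> F} := HB.pack v (GRing.isLinear.Build R E F _ v v_linear).
exists L => x x0; rewrite [LHS](@vE _ x 0) ?subr0//.
by rewrite -[in u 0](mulr0n x) uMn// mulr0n subr0.
Qed.

End LinearExtension.

(** * Finite disjoint partitions and their common refinements *)

Section Partition.
Context (R : realType) (E F : vectorLatticeType R).
Implicit Types (a b c d : E) (s t : seq E) (g : E -> F).

(* [s] is a partition of [d] into pairwise disjoint positive elements, recorded
   through successive splittings so that proofs go by induction. *)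
Inductive part : E -> seq E -> Prop :=
  | part_one d : 0 <= d -> part d [:: d]
  | part_cat a b s t : vmeet a b = 0 -> part a s -> part b t ->
      part (a + b) (s ++ t).

Definition disj_superadditive d g := forall a b, 0 <= a -> 0 <= b ->
  vmeet a b = 0 -> a + b <= d -> g a + g b <= g (a + b).

Lemma part_ge0 d s : part d s -> 0 <= d.
Proof. by elim=> // a b ? ? _ _ a0 _ b0; exact: levD_ge0. Qed.

Lemma part_mem d s c : part d s -> c \in s -> 0 <= c <= d.
Proof.
move=> h; elim: h c => [e e0|a b ? ? _ pa IHa pb IHb] c.
  by rewrite inE => /eqP ->; rewrite e0 lexx.
rewrite mem_cat => /orP[/IHa|/IHb] /andP[-> h] /=; apply: le_trans h _.
  exact/lev_addr/(part_ge0 pb).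
exact/lev_addl/(part_ge0 pa).
Qed.

Lemma part_superadd D d s g : part d s -> d <= D -> disj_superadditive D g ->
  \sum_(c <- s) g c <= g d.
Proof.
move=> h dD hg; elim: h dD => [e _|a b ? ? ab pa IHa pb IHb] abD.
  by rewrite big_seq1.
have a0 := part_ge0 pa; have b0 := part_ge0 pb.
rewrite big_cat /=; apply: le_trans (hg _ _ a0 b0 ab abD).
by apply: levD; [apply: IHa|apply: IHb]; apply: le_trans abD;
  [exact: lev_addr|exact: lev_addl].
Qed.

Lemma part_restrict a d s : 0 <= a -> part d s ->
  part (vmeet a d) [seq vmeet a y | y <- s].
Proof.
move=> a0; elim=> [e e0|x y ? ? xy px IHx py IHy] /=.
  by constructor; rewrite vmeet_ge0.
have x0 := part_ge0 px; have y0 := part_ge0 py.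
rewrite map_cat vmeetD_disj//; constructor => //.
by apply: disj_le xy; rewrite ?vmeet_ge0 ?vmeet_ler.
Qed.

(** The refinement restricts [t] to each block of [s]. Each y in [t] is the sum of its disjoint
    meets with the two sides of a splitting, so superadditivity compares the sums. The same [r]
    serves all g, which allows two functions to be handled at once. *)
Lemma part_refine D d s t : d <= D -> part d s -> part d t -> exists2 r,
  part d r & forall g, disj_superadditive D g ->
    \sum_(c <- r) g c <= \sum_(c <- s) g c /\
    \sum_(c <- r) g c <= \sum_(c <- t) g c.
Proof.
move=> dD ps; elim: ps dD t => [e _|a b s1 s2 ab pa IHa pb IHb] abD t pt.
  by exists t => // g hg; rewrite big_seq1; split => //; exact: part_superadd hg.
have a0 := part_ge0 pa; have b0 := part_ge0 pb.
have aab : a <= a + b := lev_addr _ b0; have bab : b <= a + b := lev_addl _ a0.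
have pta := part_restrict a0 pt; have ptb := part_restrict b0 pt.
rewrite (vmeet_l aab) in pta; rewrite (vmeet_l bab) in ptb.
have [r1 pr1 h1] := IHa (le_trans aab abD) _ pta.
have [r2 pr2 h2] := IHb (le_trans bab abD) _ ptb.
exists (r1 ++ r2) => [|g hg]; first by constructor.
have [h1s h1t] := h1 g hg; have [h2s h2t] := h2 g hg.
rewrite !big_cat /=; split; first exact: levD.
rewrite !big_map in h1t h2t; apply: le_trans (levD h1t h2t) _.
rewrite -big_split /=; apply: lev_sum => y /(part_mem pt)/andP[y0 yab].
have yE : vmeet a y + vmeet b y = y.
  by rewrite vmeetC (vmeetC b) -vmeetD_disj// vmeet_l.
rewrite -[in leRHS]yE; apply: hg; rewrite ?vmeet_ge0 ?yE//.
  by apply: disj_le ab; rewrite ?vmeet_ge0 ?vmeet_lel.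
exact: le_trans abD.
Qed.

End Partition.

(** * Disjointness preserving operators below the exact dominant vanish *)

Section Homomorphic.
Context (R : realType) (E F : vectorLatticeType R).

Definition disjointness_preserving (U : E -> F) := forall a b : E,
  0 <= a -> 0 <= b -> vmeet a b = 0 -> vmeet (U a) (U b) = 0.

Context (V : lmodType R) (p : latticeNorm V E).
Context (T : {linear V -> F}) (S : {linear E -> F}).

(* If [w = w1 + w2] with [T w1 - T w2] small, then [|T w| / 2] is almost below
   [S (p w1)] and below [S (p w2)], hence almost below
   [(S - U) (p w1) + (S - U) (p w2)] since [U (p w1)] and [U (p w2)] are
   disjoint. *)
Lemma order_narrow_le (U : {linear E -> F}) (w : V) :
  order_narrow p (modulus_norm F) T -> is_dominant p (modulus_norm F) T S ->
  positive_operator U -> (forall x, 0 <= x -> U x <= S x) ->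
  disjointness_preserving U ->
  modulus (T w) <= (2 : R) *: (S (p w) - U (p w)).
Proof.
have two0 : 0 <= (2 : R) by [].
move=> /(_ w)[D [v [hv [C [e [[_ [_ e_inf]] cvg]]]]]] [_ TS] U0 US Udisj.
rewrite -levB_ge0 -[X in _ <= X]opprB -[X in X <= _]oppr0; apply: levN.
apply: e_inf => _ [c _ <-]; have [a0 /(_ a0 (dle_refl _))] := cvg c.
rewrite sub0r /= modulusN; have [w1 [w2 [mc ->]]] := hv a0; rewrite linearB /=.
case: mc => [[w1w dw] [w2w _] wE].
have d12 : vmeet (p w1) (p w2) = 0.
  by rewrite /disjoint_vec wE addrAC subrr add0r in dw.
have : S (p w1) - U (p w1) + (S (p w2) - U (p w2)) <= S (p w) - U (p w).
  have h12 := disj_addle d12 w1w w2w; rewrite -levB_ge0 in h12.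
  by have := US _ h12; rewrite !linearB !linearD /= => h; linle h.
have U12 : vmeet (U (p w1)) (U (p w2)) = 0 by apply: Udisj => //; exact: vnorm_ge0.
have := TS w1; have := TS w2; rewrite wE linearD /=.
move: (T w1) (T w2) => x1 x2 h2 h1 hS he; rewrite -wE in hS *.
(* Used through x1 + x2 = 2 x1 - (x1 - x2) = 2 x2 + (x1 - x2). *)
have dbl (y z : F) : z = y + (x1 - x2) \/ z = y - (x1 - x2) ->
    modulus (y + z) <= (2 : R) *: modulus y + modulus (x1 - x2).
  have k1 := levZ2l (2 : R) _ _ two0 (le_modulus y).
  have k2 := levZ2l (2 : R) _ _ two0 (leN_modulus y).
  have l1 := le_modulus (x1 - x2); have l2 := leN_modulus (x1 - x2).
  case=> ->; rewrite modulus_le; apply/andP; split.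
  - by have h := levD k1 l1; linle h.
  - by have h := levD k2 l2; linle h.
  - by have h := levD k1 l2; linle h.
  - by have h := levD k2 l1; linle h.
have h1' : modulus (x1 + x2) <= (2 : R) *: S (p w1) + e c.
  have k : modulus (x1 + x2) <= (2 : R) *: modulus x1 + modulus (x1 - x2).
    by apply: dbl; right; lineq.
  by have h := levD k (levD he (levZ2l (2 : R) _ _ two0 h1)); linle h.
have h2' : modulus (x1 + x2) <= (2 : R) *: S (p w2) + e c.
  have k : modulus (x1 + x2) <= (2 : R) *: modulus x2 + modulus (x1 - x2).
    by rewrite [x1 + x2]addrC; apply: dbl; left; lineq.
  by have h := levD k (levD he (levZ2l (2 : R) _ _ two0 h2)); linle h.
have r1 : 0 <= S (p w1) - U (p w1) by rewrite levB_ge0 US// vnorm_ge0.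
have r2 : 0 <= S (p w2) - U (p w2) by rewrite levB_ge0 US// vnorm_ge0.
set m := modulus _ in h1' h2' *.
have k : (2^-1 : R) *: (m - e c) -
   (S (p w1) - U (p w1)) - (S (p w2) - U (p w2)) <= 0.
  have half0 : 0 <= (2^-1 : R) by rewrite invr_ge0.
  rewrite -U12 le_vmeet; apply/andP; split.
    by have h := levD (levZ2l (2^-1 : R) _ _ half0 h1') r2; linle h.
  by have h := levD (levZ2l (2^-1 : R) _ _ half0 h2') r1; linle h.
have h := levD (levZ2l (2 : R) _ _ two0 k) (levZ2l (2 : R) _ _ two0 hS).
by linle h.
Qed.

(** If W = 2^n U is below S, the previous lemma makes 2 (S - W) a dominant of T. Minimality gives S
    <= 2 (S - W), that is 2^(n+1) U <= S, and the Archimedean axiom finishes. *)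
Lemma order_narrow_disj_eq0 (U : {linear E -> F}) (x : E) :
  order_narrow p (modulus_norm F) T ->
  is_exact_dominant p (modulus_norm F) T S ->
  positive_operator U -> (forall x, 0 <= x -> U x <= S x) ->
  disjointness_preserving U -> 0 <= x -> U x = 0.
Proof.
move=> nT [TS Smin] U0 US Udisj x0.
suff h n : (2 ^+ n : R) *: U x <= S x.
  apply: (@lev_archi _ _ _ (S x)); first exact: U0.
  move=> n; apply: le_trans (h n); rewrite -scaler_nat; apply: levZ2r (U0 _ x0).
  by rewrite -natrX ler_nat ltnW// ltn_expl.
elim: n x x0 => [|n IH] x x0; first by rewrite expr0 scale1r US.
have W_linear : linear (fun x => (2 ^+ n : R) *: U x).
  by move=> a y z; rewrite linearP scalerDr !scalerA mulrC.
pose W : {linear E -> F} := HB.pack (fun x => (2 ^+ n : R) *: U x)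
  (GRing.isLinear.Build R E F _ _ W_linear).
have W0 : positive_operator W.
  by move=> y y0; rewrite levZ_ge0 ?exprn_ge0//; exact: U0.
have Wdisj : disjointness_preserving W.
  move=> a b a0 b0 ab; rewrite /= -natrX !scaler_nat disjMn ?U0//.
  exact: Udisj.
have S'_linear : linear (fun x => (2 : R) *: (S x - W x)).
  by move=> a y z; rewrite !linearP /=; lineq.
pose S' : {linear E -> F} := HB.pack (fun x => (2 : R) *: (S x - W x))
  (GRing.isLinear.Build R E F _ _ S'_linear).
have S'dom : is_dominant p (modulus_norm F) T S'.
  split=> [y y0|w] /=; last exact: (order_narrow_le (U := W)).
  by rewrite levZ_ge0// levB_ge0; exact: IH.
by have := Smin _ S'dom x x0 => /= h; rewrite exprS; linle h.
Qed.

End Homomorphic.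

(** * The part of [S] that no partition of [d] makes small *)

Section LargePieces.
Context (R : realType) (E F : vectorLatticeType R).
Context (ocE : order_complete E) (ocF : order_complete F).
Context (S : {linear E -> F}) (S_pos : positive_operator S).
Context (d : E) (d_ge0 : 0 <= d).

Let S_mono (x y : E) : x <= y -> S x <= S y.
Proof. by rewrite -levB_ge0 => /S_pos; rewrite linearB levB_ge0. Qed.

Let b (c : E) : F := vpos (S c - (2^-1 : R) *: S d).

Definition large_piece (x c : E) : F := band (b c) (S (band c x)).

Definition large_part (x : E) : F :=
  vinf [set \sum_(c <- s) large_piece x c | s in part d].

Let b_ge0 c : 0 <= b c. Proof. exact: vpos_ge0. Qed.

Let Sband_ge0 c x : 0 <= x -> 0 <= S (band c x).
Proof. by move=> x0; exact/S_pos/band_ge0. Qed.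

Lemma large_piece_ge0 x c : 0 <= x -> 0 <= large_piece x c.
Proof. by move=> x0; rewrite /large_piece band_ge0// Sband_ge0. Qed.

(** Merging two pieces enlarges both the band in E and the band in F, so refining a partition lowers
    the sum of its large pieces. *)
Lemma large_piece_superadd x : 0 <= x -> disj_superadditive d (large_piece x).
Proof.
move=> x0 a a' a0 a'0 aa' _.
have h (c c' : E) : c <= c' -> b c <= b c'.
  by move=> cc'; apply: lev_join2 => //; apply: levD2r; exact: S_mono.
have h1 := band_mono ocF (h _ _ (lev_addr a a'0)) (lexx (S (band a x))).
have h2 := band_mono ocF (h _ _ (lev_addl a' a0)) (lexx (S (band a' x))).
apply: le_trans (levD h1 h2) _; rewrite -bandD ?Sband_ge0//.
apply: band_mono => //; rewrite -linearD; apply: S_mono.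
exact: bandD_disj.
Qed.

(* Two disjoint pieces cannot both exceed half of the total. *)
Let b_disj a a' : 0 <= a -> 0 <= a' -> a + a' <= d -> vmeet (b a) (b a') = 0.
Proof.
move=> a0 a'0 aad.
apply: (disj_le _ _ (lexx (b a)) _ (vpos_disj (S a - (2^-1 : R) *: S d))) => //.
have := S_mono aad; rewrite linearD => k.
by apply: lev_join2 => //; linle k.
Qed.

Let lbound0 x : 0 <= x -> lbound [set \sum_(c <- s) large_piece x c | s in part d] 0.
Proof. by move=> x0 _ [s _ <-]; apply: lev_sum_ge0 => c _; exact: large_piece_ge0. Qed.

Lemma large_part_le x s : 0 <= x -> part d s ->
  large_part x <= \sum_(c <- s) large_piece x c.
Proof. by move=> x0 ps; apply: (vinf_le ocF (lbound0 x0)); exists s. Qed.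

Lemma large_part_min x z :
  (forall s, part d s -> z <= \sum_(c <- s) large_piece x c) ->
  z <= large_part x.
Proof.
move=> h; have dd : part d [:: d] by constructor.
apply: (vinf_ge ocF (x := \sum_(c <- [:: d]) large_piece x c)).
  by exists [:: d].
by move=> _ [s ps <-]; exact: h.
Qed.

Let large_part_ge0 x : 0 <= x -> 0 <= large_part x.
Proof.
move=> x0; apply: large_part_min => s ps.
by apply: lev_sum_ge0 => c _; exact: large_piece_ge0.
Qed.

Let large_pieceD x y s : 0 <= x -> 0 <= y -> part d s ->
  \sum_(c <- s) large_piece (x + y) c =
    \sum_(c <- s) large_piece x c + \sum_(c <- s) large_piece y c.
Proof.
move=> x0 y0 ps; rewrite -big_split; apply: eq_big_seq => c cs /=.
have /andP[c0 _] := part_mem ps cs.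
by rewrite /large_piece !bandD// linearD bandD ?Sband_ge0.
Qed.

Let large_partD x y : 0 <= x -> 0 <= y ->
  large_part (x + y) = large_part x + large_part y.
Proof.
move=> x0 y0; have xy0 := levD_ge0 x0 y0.
apply/le_anti/andP; split.
  suff h : large_part (x + y) - large_part y <= large_part x by linle h.
  apply: large_part_min => s ps.
  suff h : large_part (x + y) - \sum_(c <- s) large_piece x c <= large_part y.
    by linle h.
  apply: large_part_min => t pt.
  (* The partitions nearly optimal for x and for y may differ; a common refinement is at least as
     good for both. *)
  have [r pr hr] := part_refine F (lexx d) ps pt.
  have [h1 _] := hr _ (large_piece_superadd x0).
  have [_ h2] := hr _ (large_piece_superadd y0).
  have := large_part_le xy0 pr; rewrite large_pieceD// => h3.
  by have h := levD h3 (levD h1 h2); linle h.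
apply: large_part_min => s ps; rewrite large_pieceD//.
by apply: levD; exact: large_part_le.
Qed.

Let large_part_leS x : 0 <= x -> large_part x <= S x.
Proof.
move=> x0; apply: le_trans (large_part_le x0 (part_one d_ge0)) _.
by rewrite big_seq1 (le_trans (band_le ocF _ _))// S_mono// band_le.
Qed.

(** Split d into its projection c on the band of x and the rest c'. The piece c' does not see x and
    c does not see y, so the two values lie in the bands of [b c] and [b c'], which are disjoint. *)
Let large_part_disj : disjointness_preserving large_part.
Proof.
move=> x y x0 y0 xy; set c := band x d; set c' := d - c.
have c0 : 0 <= c by exact: band_ge0.
have c'0 : 0 <= c' by rewrite levB_ge0 band_le.
have [c'x cc'] := band_compl ocE x0 d_ge0.
have ps : part d [:: c; c'].
  rewrite -[d in part d](subrK c) addrC.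
  by apply: (part_cat (s := [:: c]) (t := [:: c'])); rewrite //; exact: part_one.
have cy : vmeet c y = 0 by exact: band_disj.
have piece0 e z : 0 <= e -> 0 <= z -> vmeet e z = 0 -> large_piece z e = 0.
  move=> e0 z0 ez.
  rewrite /large_piece (band_eq0 ocE e0 z0); last by rewrite vmeetC.
  by rewrite linear0; apply: band_eq0 => //; rewrite vmeet_l.
apply: (disj_le (large_part_ge0 x0) (large_part_ge0 y0)
  (large_part_le x0 ps) (large_part_le y0 ps)).
rewrite !big_cons !big_nil (piece0 c' x)// (piece0 c y)// !addr0 add0r.
apply: band_disj2; rewrite ?Sband_ge0//.
by apply: b_disj => //; rewrite /c' addrC subrK.
Qed.

Lemma large_part_eq0 (V : lmodType R) (p : latticeNorm V E)
    (T : {linear V -> F}) (x : E) :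
  order_narrow p (modulus_norm F) T ->
  is_exact_dominant p (modulus_norm F) T S -> 0 <= x -> large_part x = 0.
Proof.
move=> nT domS x0.
have [U UE] := Kantorovich_extension large_part_ge0 large_partD.
rewrite -UE//; apply: order_narrow_disj_eq0 nT domS _ _ _ x0.
- by move=> y y0; rewrite UE// large_part_ge0.
- by move=> y y0; rewrite UE// large_part_leS.
- by move=> y z y0 z0; rewrite !UE//; exact: large_part_disj.
Qed.

(** The excess [b c] is at most S c, hence at most S of the projection of d on the band of c; being
    in its own band, it is below the large piece at c. *)
Lemma part_le_large s c : part d s -> c \in s ->
  S c <= (2^-1 : R) *: S d + \sum_(c <- s) large_piece d c.
Proof.
move=> ps cs; have /andP[c0 cd] := part_mem ps cs.
have h1 : S c - (2^-1 : R) *: S d <= b c by exact: le_vpos.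
suff h2 : b c <= \sum_(c <- s) large_piece d c by have h := levD h1 h2; linle h.
apply: (@le_trans _ _ (large_piece d c)); last first.
  rewrite (big_rem c cs) /= lev_addr//.
  by apply: lev_sum_ge0 => e _; exact: large_piece_ge0.
have bS : b c <= S c.
  have half0 : 0 <= (2^-1 : R) by rewrite invr_ge0.
  have h := levZ_ge0 half0 (S_pos d_ge0).
  by rewrite vpos_le S_pos// andbT; linle h.
have cb : c <= band c d.
  by apply: le_trans (band_meet ocE _ _); rewrite vmeetC vmeet_l.
apply: le_trans (band_meet ocF _ _); rewrite le_vmeet lexx andbT.
exact/(le_trans bS)/S_mono.
Qed.

End LargePieces.

(** * The Hahn-Banach theorem for sublinear functionals *)

Section HahnBanach.
Context (R : realType) (V : lmodType R).
Implicit Types (x y : V).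

Definition sublinear (s : V -> R) := (forall x y, s (x + y) <= s x + s y) /\
  (forall (a : R) x, 0 <= a -> s (a *: x) = a * s x).

Lemma sublinear_of_le (s : V -> R) : (forall x y, s (x + y) <= s x + s y) ->
  (forall (a : R) x, 0 < a -> s (a *: x) <= a * s x) -> s 0 = 0 -> sublinear s.
Proof.
move=> sD sZ s0; split=> // a x; rewrite le_eqVlt => /predU1P[<-|a0].
  by rewrite scale0r mul0r s0.
apply/le_anti; rewrite sZ//= -ler_pdivlMl//.
have := sZ a^-1 (a *: x); rewrite scalerA mulVf ?gt_eqF// scale1r.
by apply; rewrite invr_gt0.
Qed.

Lemma sublinear0 (s : V -> R) : sublinear s -> s 0 = 0.
Proof. by move=> [_ sZ]; rewrite -(scale0r (0 : V)) sZ// mul0r. Qed.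

Lemma sublinear_opp (s : V -> R) x : sublinear s -> - s (- x) <= s x.
Proof.
move=> ss; have [sD _] := ss; have := sD x (- x).
by rewrite subrr (sublinear0 ss); lra.
Qed.

(** For sublinear s this is a sublinear functional below s that is at most - s y at - y; a minimal s
    must equal it, hence be odd along y. *)
Definition tilt (s : V -> R) y x : R :=
  inf [set s (x + t *: y) - t * s y | t in [set t | 0 <= t]].

Lemma tilt_min (s : V -> R) y x c :
  (forall t, 0 <= t -> c <= s (x + t *: y) - t * s y) -> c <= tilt s y x.
Proof.
move=> h; apply: lb_le_inf; first by exists (s (x + 0 *: y) - 0 * s y), 0 => /=.
by move=> _ [t t0 <-]; exact: h.
Qed.

(** Bounds the set in [tilt] from below, without which [inf] would be a mere default value. *)
Lemma tilt_lbound (s : V -> R) y x t : sublinear s -> 0 <= t ->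
  - s (- x) <= s (x + t *: y) - t * s y.
Proof.
move=> [sD sZ] t0; rewrite -sZ//.
by have := sD (x + t *: y) (- x); rewrite addrAC subrr add0r; lra.
Qed.

Lemma tilt_le (s : V -> R) y x t : sublinear s -> 0 <= t ->
  tilt s y x <= s (x + t *: y) - t * s y.
Proof.
move=> ss t0; apply: ge_inf; last by exists t.
by exists (- s (- x)) => _ [r r0 <-]; exact: tilt_lbound.
Qed.

Lemma sublinear_tilt (s : V -> R) y : sublinear s -> sublinear (tilt s y).
Proof.
move=> ss; have [sD sZ] := ss; apply: sublinear_of_le.
- move=> x x'; rewrite -lerBlDr; apply: tilt_min => t t0.
  rewrite lerBlDr -lerBlDl; apply: tilt_min => t' t'0.
  have tt0 := addr_ge0 t0 t'0.
  have h := tilt_le y (x + x') ss tt0; have := sD (x + t *: y) (x' + t' *: y).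
  by rewrite addrACA -scalerDl; lra.
- move=> a x a0; rewrite -ler_pdivrMl//; apply: tilt_min => t t0.
  rewrite ler_pdivrMl//; have at0 := mulr_ge0 (ltW a0) t0.
  apply: le_trans (tilt_le y (a *: x) ss at0) _.
  by have := sZ a (x + t *: y) (ltW a0); rewrite scalerDr scalerA => ->; lra.
- apply/le_anti/andP; split.
    have := tilt_le y 0 ss (lexx 0).
    by rewrite scale0r addr0 (sublinear0 ss) mul0r subr0.
  apply: tilt_min => t t0; have := tilt_lbound y 0 ss t0.
  by rewrite oppr0 (sublinear0 ss) oppr0.
Qed.

Lemma tilt_le_id (s : V -> R) y x : sublinear s -> tilt s y x <= s x.
Proof.
by move=> ss; have := tilt_le y x ss (lexx 0); rewrite scale0r addr0 mul0r subr0.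
Qed.

Lemma tilt_opp (s : V -> R) y : sublinear s -> tilt s y (- y) <= - s y.
Proof.
move=> ss; have := tilt_le y (- y) ss ler01.
by rewrite scale1r addNr (sublinear0 ss) mul1r sub0r.
Qed.

(* A minimal sublinear functional is linear: it coincides with all its tilts. *)
Lemma Hahn_Banach (q : V -> R) x0 : sublinear q ->
  exists phi : {scalar V}, (forall x, phi x <= q x) /\ phi x0 = q x0.
Proof.
move=> qq.
(* The bound at - x0 is what yields phi x0 >= q x0 once s is linear; the tilt of q along x0 is a
   first candidate. *)
pose T := {s : V -> R | sublinear s /\
  ((forall x, s x <= q x) /\ s (- x0) <= - q x0)}.
pose t0 : T := exist _ (tilt q x0) (conj (sublinear_tilt x0 qq)
  (conj (fun x => tilt_le_id x0 x qq) (tilt_opp x0 qq))).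
(* The order is reversed, so that a Zorn-maximal element is pointwise minimal; a nonempty chain is
   bounded by its pointwise infimum. *)
pose le_T : rel T := fun s t => `[< forall x, sval t x <= sval s x >].
have [||A Atot|s smax] := @ZL_preorder T t0 le_T.
- by move=> s; apply/asboolP.
- by move=> r s t /asboolP rs /asboolP st; apply/asboolP => x; exact: le_trans (rs x).
- have [[t1 At1]|A0] := pselect (A !=set0); last first.
    by exists t0 => s As; exfalso; apply: A0; exists s.
  pose S x := [set sval s x | s in A].
  have Slb x : lbound (S x) (- q (- x)).
    move=> _ [[s [ss [sq _]]] _ <-] /=; apply: le_trans (sublinear_opp x ss).
    by rewrite lerN2.
  pose m x := inf (S x).
  have m_le x s : A s -> m x <= sval s x.
    by move=> As; apply: ge_inf; [exists (- q (- x))|exists s].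
  have m_min x c : (forall s, A s -> c <= sval s x) -> c <= m x.
    move=> h; apply: lb_le_inf; first by exists (sval t1 x), t1.
    by move=> _ [s As <-]; exact: h.
  have mm : sublinear m.
    apply: sublinear_of_le.
    + move=> x y; rewrite -lerBlDr; apply: (m_min _ _) => s As.
      rewrite lerBlDr -lerBlDl; apply: (m_min _ _) => t At; rewrite lerBlDl.
      have [/asboolP st|/asboolP ts] := Atot s t As At.
        have [[tD _] _] := svalP t; apply: le_trans (m_le _ _ At) _.
        by apply: le_trans (tD x y) _; rewrite lerD2r st.
      have [[sD _] _] := svalP s; apply: le_trans (m_le _ _ As) _.
      by apply: le_trans (sD x y) _; rewrite lerD2l ts.
    + move=> a x a0; rewrite -ler_pdivrMl//; apply: (m_min _ _) => s As.
      rewrite ler_pdivrMl//; have [[_ sZ] _] := svalP s.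
      by have <- := sZ a x (ltW a0); exact: (m_le _ _ As).
    + apply/le_anti/andP; split.
        have [ss _] := svalP t1.
        by have := m_le 0 _ At1; rewrite (sublinear0 ss).
      by apply: (m_min _ _) => s As; have [ss _] := svalP s; rewrite (sublinear0 ss).
  have mq x : m x <= q x.
    by have [_ [h _]] := svalP t1; exact: le_trans (m_le x _ At1) (h x).
  have mx0 : m (- x0) <= - q x0.
    by have [_ [_ h]] := svalP t1; exact: le_trans (m_le _ _ At1) h.
  exists (exist _ m (conj mm (conj mq mx0))) => s As; apply/asboolP => x /=.
  exact: m_le.
case: s smax => s [ss [sq sx0]] smax; have [sD sZ] := ss.
have sN y : s (- y) = - s y.
  have tT : sublinear (tilt s y) /\
      ((forall x, tilt s y x <= q x) /\ tilt s y (- x0) <= - q x0).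
    split; first exact: sublinear_tilt.
    split=> [x|]; first exact: le_trans (tilt_le_id y x ss) _.
    exact: le_trans (tilt_le_id y _ ss) _.
  have /smax/asboolP/(_ (- y)) /= h :
      le_T (exist _ s (conj ss (conj sq sx0))) (exist _ _ tT).
    by apply/asboolP => x /=; exact: tilt_le_id.
  apply/le_anti/andP; split; first exact: le_trans h (tilt_opp y ss).
  by have := sublinear_opp y ss; lra.
have sadd x y : s (x + y) = s x + s y.
  apply/le_anti; rewrite sD /= -[X in _ <= X]opprK -sN opprD.
  by have := sD (- x) (- y); rewrite !sN; lra.
have s_linear : linear_for *%R s.
  move=> a x y; rewrite sadd; congr (_ + _).
  have [a0|a0] := leP 0 a; first exact: sZ.
  rewrite -[a in LHS]opprK scaleNr sN sZ ?oppr_ge0 ?ltW//.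
  by rewrite mulNr opprK.
pose phi : {scalar V} := HB.pack s (GRing.isLinear.Build R V R *%R s s_linear).
exists phi; split=> [x|]; first exact: sq.
by apply/le_anti; rewrite sq /= -[X in _ <= X]opprK -sN; rewrite lerNr.
Qed.

End HahnBanach.

(** * Order continuous positive functionals *)

Section OrderContinuousForms.
Context (R : realType) (F : vectorLatticeType R).
Implicit Types (x y f : F) (phi psi : {scalar F}) (N : F -> R).

Definition down_directed (A : set F) := A !=set0 /\
  forall x y, A x -> A y -> exists z, [/\ A z, z <= x & z <= y].

(** Order continuity at 0, phrased with directed sets. When m is monotone on positive elements, one
    small value controls all members of A below it. *)
Definition vanishing (m : F -> R) := forall A : set F, down_directed A ->
  infimums A 0 -> forall eps : R, 0 < eps -> exists2 a, A a & m a < eps.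

Record oc_norm N : Prop := OcNorm {
  oc_norm_mono : forall x y, 0 <= x -> x <= y -> N x <= N y ;
  oc_normD : forall x y, N (x + y) <= N x + N y ;
  oc_normZ : forall (a : R) x, 0 <= a -> N (a *: x) = a * N x ;
  oc_norm_eq0 : forall x, N x = 0 -> x = 0 ;
  oc_norm_vanishing : vanishing N }.

Record oc_form phi : Prop := OcForm {
  oc_form_ge0 : forall x, 0 <= x -> 0 <= phi x ;
  oc_form_vanishing : vanishing phi }.

Lemma oc_form_mono phi x y : oc_form phi -> x <= y -> phi x <= phi y.
Proof.
by move=> op; rewrite -levB_ge0 => /(oc_form_ge0 op); rewrite linearB /= subr_ge0.
Qed.

Lemma oc_formD phi psi (chi : {scalar F}) : oc_form phi -> oc_form psi ->
  (forall x, chi x = phi x + psi x) -> oc_form chi.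
Proof.
move=> p1 p2 chiE; split=> [x x0|A dA iA eps e0].
  by rewrite chiE addr_ge0 ?(oc_form_ge0 p1) ?(oc_form_ge0 p2).
have e2 : 0 < eps / 2 by rewrite divr_gt0.
have [a Aa ha] := oc_form_vanishing p1 dA iA e2.
have [b Ab hb] := oc_form_vanishing p2 dA iA e2.
have [c [Ac ca cb]] := dA.2 _ _ Aa Ab; exists c => //; rewrite chiE.
have := oc_form_mono p1 ca; have := oc_form_mono p2 cb; lra.
Qed.

(** The norm is pulled back along the embedding j. An infimum 0 in F stays an infimum 0 in G because
    the range is an ideal: the positive part of a lower bound lies below some j x1, hence is itself
    in the range. *)
Lemma ideal_oc_norm : ideal_of_oc_banach_lattice F -> exists N, oc_norm N.
Proof.
move=> [G [n [j [n_oc j_mono [_ _ j_ideal]]]]].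
have j_ge0 x : (0 <= j x) = (0 <= x) by rewrite -[0](linear0 j) j_mono.
exists (fun x => n (j x)); split.
- move=> x y x0 xy; apply: bnorm_modulus.
  by rewrite !modulus_id ?j_ge0 ?j_mono//; exact: le_trans xy.
- by move=> x y; rewrite linearD; exact: bnormD.
- by move=> a x a0; rewrite linearZ /= bnormZ ger0_norm.
- by move=> x /bnorm0_eq0 jx; apply/le_anti; rewrite -!j_mono linear0 jx lexx.
move=> A [[x1 Ax1] dA] [A_lb A_inf] eps e0.
pose K := {x | A x}; pose le_A (x y : K) := sval y <= sval x.
have le_A_trans (x y z : K) : le_A x y -> le_A y z -> le_A x z.
  by move=> xy yz; exact: le_trans yz xy.
have le_A_dir (x y : K) : exists z, le_A x z /\ le_A y z.
  have [z [Az zx zy]] := dA _ _ (svalP x) (svalP y).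
  by exists (exist _ z Az).
pose D := @DirectedSet K le_A (exist _ x1 Ax1)
  (fun x : K => lexx (sval x)) le_A_trans le_A_dir.
have dec : decreasing_to0 (fun x : D => j (sval x)).
  split=> [a b|]; first by rewrite j_mono.
  split=> [_ [x _ <-]|g hg].
    by rewrite j_ge0; apply: A_lb; exact: svalP.
  have gx x : A x -> vpos g <= j x.
    move=> Ax; rewrite vpos_le j_ge0 A_lb// andbT.
    by apply: hg; exists (exist _ x Ax).
  have [w _ wE] : range j (vpos g).
    apply: (j_ideal (j x1)); last by exists x1.
    by rewrite !modulus_id ?gx ?vpos_ge0// j_ge0 A_lb.
  apply: le_trans (le_vpos g) _; rewrite -wE -[0](linear0 j) j_mono.
  by apply: A_inf => x Ax; rewrite -j_mono wE gx.
have [a0 /(_ a0 (dle_refl _)) ha0] := n_oc _ _ dec _ e0.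
by exists (sval a0) => //; exact: svalP.
Qed.

Context (N : F -> R) (N_oc : oc_norm N).

Lemma oc_norm0 : N 0 = 0.
Proof. by rewrite -(scale0r (0 : F)) (oc_normZ N_oc)// mul0r. Qed.

(** Hahn-Banach for q y = N (y^+). Since q vanishes on negative elements, phi <= q makes phi
    positive, and it also transfers order continuity from N to phi. *)
Lemma oc_form_exists x : 0 <= x -> exists phi, oc_form phi /\ phi x = N x.
Proof.
move=> x0; pose q y := N (vpos y).
have [|phi [phi_le phix]] := @Hahn_Banach R F q x.
  split=> [y z|a y a0].
    apply: le_trans (oc_normD N_oc _ _).
    apply: (oc_norm_mono N_oc); first exact: vpos_ge0.
    by rewrite vpos_le levD ?le_vpos//= levD_ge0 ?vpos_ge0.
  rewrite /q -(oc_normZ N_oc)//; congr N.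
  have vposZ_le (b : R) (z : F) : 0 <= b -> vpos (b *: z) <= b *: vpos z.
    by move=> b0; rewrite vpos_le levZ_ge0 ?vpos_ge0// levZ2l// le_vpos.
  apply/le_anti; rewrite vposZ_le//=; have [->|an0] := eqVneq a 0.
    by rewrite scale0r vpos_ge0.
  have := vposZ_le a^-1 (a *: y); rewrite invr_ge0 scalerA mulVf// scale1r.
  by move=> /(_ a0)/(levZ2l a _ _ a0); rewrite scalerA divff// scale1r.
exists phi; rewrite phix /q vpos_id//; split=> //; split=> [y y0|A dA iA eps e0].
  have := phi_le (- y); rewrite linearN /q; have -> : vpos (- y) = 0.
    by apply/le_anti; rewrite vpos_ge0 vpos_le lexx !andbT -oppr0 levN.
  by rewrite oc_norm0 /=; lra.
have [a Aa Na] := oc_norm_vanishing N_oc dA iA e0; exists a => //.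
by apply: le_lt_trans (phi_le a) _; rewrite /q vpos_id// iA.1.
Qed.

Context (ocF : order_complete F).

(** The null elements in [0, f] are closed under joins, so the differences from their supremum are
    directed down to 0 and order continuity makes the supremum null too. *)
Lemma oc_form_null_sup phi f : oc_form phi -> 0 <= f -> exists z,
  [/\ 0 <= z, z <= f, phi z = 0 & forall x, 0 <= x <= f -> phi x = 0 -> x <= z].
Proof.
move=> op f0; pose B := [set x | 0 <= x <= f /\ phi x = 0].
have B0 : B 0 by rewrite /B /= lexx f0 linear0.
have Bub : ubound B f by move=> x [/andP[]].
pose z := vsup B.
have zge x : B x -> x <= z by move=> Bx; exact: vsup_ge Bub Bx.
have z0 : 0 <= z by exact: zge.
exists z; split => //.
- exact: vsup_le B0 Bub.
- apply/le_anti/andP; split; last exact: oc_form_ge0.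
  apply/ler_addgt0Pl => eps e0; rewrite addr0.
  have [||_ [x Bx <-]] := oc_form_vanishing op (A := [set z - x | x in B]) _ _ e0.
  + split; first by exists (z - 0), 0.
    move=> _ _ [x [/andP[x0 xf] px] <-] [y [/andP[y0 yf] py] <-].
    exists (z - vjoin x y); split.
    * exists (vjoin x y) => //; split.
        by rewrite vjoin_le xf yf andbT (le_trans x0 (le_vjoinl _ _)).
      apply/le_anti/andP; split.
        rewrite -[X in _ <= X]addr0 -{1}px -py -linearD /=.
        by apply: oc_form_mono => //; rewrite vjoin_le lev_addr// lev_addl.
      by apply: oc_form_ge0 => //; exact: le_trans x0 (le_vjoinl _ _).
    * by have h := le_vjoinl x y; linle h.
    * by have h := le_vjoinr x y; linle h.
  + split=> [_ [x Bx <-]|y hy]; first by rewrite levB_ge0 zge.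
    suff h : z <= z - y by linle h.
    apply: (vsup_le ocF B0) => x Bx.
    by have h : y <= z - x; [by apply: hy; exists x|linle h].
  + by rewrite linearB /= Bx.2 subr0 => /ltW.
- by move=> x x0f px; apply: zge.
Qed.

(** [A] collects bounds for the null elements of some form; adding forms shows that it is directed.
    If y is a lower bound of [A], take a form with value N (y^+) at y^+: its largest null element is
    in [A], so y^+ is null for it and N (y^+) = 0. Thus [A] has infimum 0 and contains elements of
    arbitrarily small norm. *)
Lemma strictly_positive_forms f : 0 <= f -> exists phi : nat -> {scalar F},
  [/\ forall n, oc_form (phi n),
      forall m n x, (m <= n)%N -> 0 <= x -> phi m x <= phi n x
    & forall x, 0 <= x <= f -> (forall n, phi n x = 0) -> x = 0].
Proof.
move=> f0; pose A := [set z | 0 <= z <= f /\ exists2 phi : {scalar F},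
  oc_form phi & forall x, 0 <= x <= f -> phi x = 0 -> x <= z].
have Af : A f.
  split; first by rewrite f0 lexx.
  have [phi [op _]] := oc_form_exists f0.
  by exists phi => // x /andP[].
have dA : down_directed A.
  split; first by exists f.
  move=> x y [/andP[x0 xf] [phi op hp]] [/andP[y0 yf] [psi oq hq]].
  exists (vmeet x y); split; [|exact: vmeet_lel|exact: vmeet_ler].
  split; first by rewrite vmeet_ge0//= (le_trans (vmeet_lel _ _) xf).
  have op' : oc_form (phi \+ psi : {scalar F}) by exact: oc_formD op oq _.
  exists (phi \+ psi : {scalar F}) => // z zf /= h.
  have /andP[z0 _] := zf.
  have a0 := oc_form_ge0 op z0; have b0 := oc_form_ge0 oq z0.
  by rewrite le_vmeet hp ?hq//; lra.
have iA : infimums A 0.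
  split=> [z [/andP[]]//|y hy]; apply: le_trans (le_vpos y) _.
  have xz z : A z -> vpos y <= z.
    by move=> Az; rewrite vpos_le hy//; have [/andP[]] := Az.
  have [phi [op phix]] := oc_form_exists (vpos_ge0 y).
  have [z [z0 zf pz zmax]] := oc_form_null_sup op f0.
  have Az : A z by split; [rewrite z0|exists phi].
  suff /(oc_norm_eq0 N_oc) -> : N (vpos y) = 0 by [].
  rewrite -phix; apply/le_anti; rewrite oc_form_ge0 ?vpos_ge0// andbT -pz.
  by apply: oc_form_mono => //; exact: xz.
have choice_z n : {zp : F * {scalar F} | [/\ N zp.1 < n.+1%:R^-1, oc_form zp.2
    & forall x, 0 <= x <= f -> zp.2 x = 0 -> x <= zp.1]}.
  apply: cid; have e0 : (0 : R) < n.+1%:R^-1 by rewrite invr_gt0.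
  have [z [_ [phi op h]] Nz] := oc_norm_vanishing N_oc dA iA e0.
  by exists (z, phi).
pose psi n : {scalar F} := (sval (choice_z n)).2.
have psi_oc n : oc_form (psi n) by have [] := svalP (choice_z n).
(* Partial sums of the [psi n] increase on positive elements and have the same common zeros. *)
pose phi := fix phi n : {scalar F} :=
  if n is m.+1 then (phi m \+ psi n : {scalar F}) else psi 0%N.
have phi_oc n : oc_form (phi n).
  by elim: n => [|n IH] //=; exact: oc_formD IH (psi_oc n.+1) _.
have phi_mono m n x : (m <= n)%N -> 0 <= x -> phi m x <= phi n x.
  move=> + x0; elim: n => [|n IH]; first by rewrite leqn0 => /eqP ->.
  rewrite leq_eqVlt => /predU1P[->//|]; rewrite ltnS => /IH h.
  by apply: le_trans h _; rewrite /= lerDl oc_form_ge0.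
exists phi; split=> // x /[dup] xf /andP[x0 _] px; apply: (oc_norm_eq0 N_oc).
have psi0 n : psi n x = 0.
  case: n => [|n]; first exact: px 0%N.
  by have := px n.+1; rewrite /= px add0r.
have Nx n : N x < n.+1%:R^-1.
  have [Nz _ /(_ x xf (psi0 n)) xz] := svalP (choice_z n).
  exact: le_lt_trans (oc_norm_mono N_oc x0 xz) Nz.
apply/le_anti/andP; split; last first.
  by rewrite -oc_norm0; exact: oc_norm_mono.
apply/ler_addgt0Pl => eps e0; rewrite addr0.
have [k] := ltr_add_invr e0; rewrite add0r => ke.
exact/ltW/(lt_trans (Nx k)).
Qed.

End OrderContinuousForms.

(** * Diffuse operators: derivation from narrowness, and iterated halving *)

Section Diffuse.
Context (R : realType) (E F : vectorLatticeType R).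

Definition diffuse (S : {linear E -> F}) := forall (phi : {scalar F}) (d : E)
    (eps : R), oc_form phi -> 0 <= d -> 0 < eps ->
  exists s g, [/\ part d s, 0 <= g, phi g < eps &
    forall c, c \in s -> S c <= (2^-1 : R) *: S d + g].

(** The error is the sum of the large pieces of a partition. These sums are directed downwards by
    refinement and their infimum, the large part of d, is 0. *)
Lemma order_narrow_diffuse (V : lmodType R) (p : latticeNorm V E)
    (T : {linear V -> F}) (S : {linear E -> F}) :
  order_complete E -> order_complete F -> order_narrow p (modulus_norm F) T ->
  is_exact_dominant p (modulus_norm F) T S -> diffuse S.
Proof.
move=> ocE ocF nT domS phi d eps ophi d0 e0; have [[S0 _] _] := domS.
pose g s := \sum_(c <- s) large_piece S d d c.
have g0 s : 0 <= g s by apply: lev_sum_ge0 => c _; exact: large_piece_ge0.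
have [||_ [s ps <-] gs] :=
    oc_form_vanishing ophi (A := [set g s | s in part d]) _ _ e0.
- split; first by exists (g [:: d]), [:: d] => //; exact: part_one.
  move=> _ _ [s ps <-] [t pt <-].
  have [r pr hr] := part_refine F (lexx d) ps pt.
  have [h1 h2] := hr _ (large_piece_superadd ocE ocF S0 (d := d) d0).
  by exists (g r); split=> //; exists r.
- split=> [_ [s _ <-]//|y hy].
  rewrite -(large_part_eq0 ocE ocF S0 d0 nT domS d0).
  by apply: large_part_min => // s ps; apply: hy; exists s.
- exists s, (g s); split=> // c cs; exact: part_le_large.
Qed.

Context (S : {linear E -> F}) (S_diffuse : diffuse S).

(** Diffuseness is applied block by block; at each splitting either side receives half of the error
    budget. *)
Lemma diffuse_part (phi : {scalar F}) d s (eps : R) : oc_form phi ->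
  part d s -> 0 < eps -> exists s' g, [/\ part d s', 0 <= g, phi g < eps &
    forall c, c \in s' -> exists2 a, a \in s & S c <= (2^-1 : R) *: S a + g].
Proof.
move=> ophi ps; elim: ps eps => [e e0|a b s1 s2 ab pa IHa pb IHb] eps eps0.
  have [s' [g [ps' g0 gs h]]] := S_diffuse ophi e0 eps0.
  by exists s', g; split=> // c /h cs; exists e; rewrite ?mem_head.
have e2 : 0 < eps / 2 by rewrite divr_gt0.
have [t1 [g1 [pt1 g10 gs1 h1]]] := IHa _ e2.
have [t2 [g2 [pt2 g20 gs2 h2]]] := IHb _ e2.
exists (t1 ++ t2), (g1 + g2); split.
- exact: part_cat.
- exact: levD_ge0.
- by rewrite linearD /=; lra.
move=> c; rewrite mem_cat => /orP[/h1|/h2] [x xs hx]; exists x.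
- by rewrite mem_cat xs.
- by have h := levD hx g20; linle h.
- by rewrite mem_cat xs orbT.
- by have h := levD hx g10; linle h.
Qed.

Lemma diffuse_iter n (phi : {scalar F}) d (eps : R) : oc_form phi ->
  0 <= d -> 0 < eps -> exists s g, [/\ part d s, 0 <= g, phi g < eps &
    forall c, c \in s -> S c <= ((2 ^ n)%:R^-1 : R) *: S d + g].
Proof.
move=> ophi d0; elim: n eps => [|n IH] eps e0.
  exists [:: d], 0; split; rewrite ?linear0//; first exact: part_one.
  by move=> c; rewrite inE => /eqP ->; rewrite expn0 invr1 scale1r addr0.
have e2 : 0 < eps / 2 by rewrite divr_gt0.
have [s [g [ps g0 gs h]]] := IH _ e2.
have [s' [g' [ps' g'0 gs' h']]] := diffuse_part ophi ps e2.
(* Halving the bound also halves the error of the earlier rounds. *)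
exists s', ((2^-1 : R) *: g + g'); split=> //.
- by rewrite levD_ge0// levZ_ge0// invr_ge0.
- by rewrite linearD linearZ /=; lra.
move=> c /h'[a /h ha hc].
have half0 : 0 <= (2^-1 : R) by rewrite invr_ge0.
rewrite expnS natrM invfM.
by have k := levD hc (levZ2l (2^-1 : R) _ _ half0 ha); linle k.
Qed.

End Diffuse.

(** * Sums of excesses over a threshold *)

Section Counting.
Context (R : realType) (F : vectorLatticeType R) (I : eqType).
Implicit Types (s t : seq I) (x f : I -> F).

Lemma lev_sum_subseq s t f : (forall i, i \in s -> 0 <= f i) -> subseq t s ->
  \sum_(i <- t) f i <= \sum_(i <- s) f i.
Proof.
elim: s t => [|i s IH] [|j t] //= f0.
- by move=> _; rewrite big_nil big_seq lev_sum_ge0.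
- have fs k : k \in s -> 0 <= f k by move=> ks; rewrite f0// in_cons ks orbT.
  rewrite [X in _ <= X]big_cons; case: eqP => [->|_] /(IH _ fs) h.
    by rewrite big_cons levD.
  by apply: le_trans h _; rewrite lev_addl// f0// mem_head.
Qed.

(** Each positive part amounts to keeping or dropping its term, so bounds on all subsequence sums
    suffice. *)
Lemma sum_vpos_le s x z :
  (forall t, subseq t s -> \sum_(i <- t) x i <= z) ->
  \sum_(i <- s) vpos (x i) <= z.
Proof.
elim: s z => [|i s IH] z h; first by have := h [::] isT; rewrite !big_nil.
rewrite big_cons.
suff k : \sum_(j <- s) vpos (x j) <= z - vpos (x i) by linle k.
apply: IH => t ts; suff k : vpos (x i) <= z - \sum_(j <- t) x j by linle k.
rewrite vpos_le; apply/andP; split.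
  have := h (i :: t); rewrite big_cons /= eqxx => /(_ ts) k; linle k.
by rewrite levB_ge0; apply: h; exact: subseq_trans ts (subseq_cons _ _).
Qed.

(* At most [m] of the [f i] can exceed [h / m]. *)
Lemma sum_excess_le s f g h m : (0 < m)%N ->
  (forall i, i \in s -> 0 <= f i) -> 0 <= g -> \sum_(i <- s) f i <= h ->
  (forall i, i \in s -> f i <= (m%:R^-1 : R) *: h + g) ->
  \sum_(i <- s) vpos (f i - (m%:R^-1 : R) *: h) <= g *+ m.
Proof.
move=> m0 f0 g0 sh fh; apply: sum_vpos_le => t ts.
have h0 : 0 <= h by apply: le_trans sh; rewrite big_seq; exact: lev_sum_ge0.
(* At most m terms contribute at most g each; with more than m terms, the subtracted multiples of h
   / m already outweigh the total h. *)
have [tm|mt] := leqP (size t) m.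
  apply: (@le_trans _ _ (\sum_(i <- t) g)).
    apply: lev_sum => i /(mem_subseq ts)/fh k; linle k.
  by rewrite big_const_seq count_predT iter_addr_0 levMnr.
apply: le_trans (levMn_ge0 m g0).
rewrite big_split /= big_const_seq count_predT iter_addr_0.
have k1 := le_trans (lev_sum_subseq f0 ts) sh.
suff k2 : h <= (m%:R^-1 : R) *: h *+ size t.
  by have k := levD k1 k2; rewrite mulNrn; linle k.
rewrite -[X in _ <= X]scaler_nat scalerA -[X in X <= _]scale1r levZ2r//.
by rewrite ler_pdivlMr ?ltr0n// mul1r ler_nat ltnW.
Qed.

End Counting.

(** * The quadratic potential *)

Section Quadratic.
Context (R : realType) (F : vectorLatticeType R) (ocF : order_complete F).
Context (f : F) (f0 : 0 <= f).
Implicit Types x y z : F.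

(* The element [x^2 / f] of the vector lattice. *)
Definition quad x : F :=
  vsup (range (fun t : R => (2 * t) *: x - (t ^+ 2) *: f)).

(** The square (1 - |t|)^2 bounds the whole family by f, so the supremum defining [quad] exists. *)
Lemma quad_ge x t : modulus x <= f -> (2 * t) *: x - (t ^+ 2) *: f <= quad x.
Proof.
move=> xf; apply: (vsup_ge ocF (m := f)); last by exists t.
move=> _ [r _ <-]; have h1 : (2 * r) *: x <= (2 * `|r|) *: f.
  apply: le_trans (le_modulus _) _; rewrite modulusZ normrM normr_nat.
  by apply: levZ2l => //; rewrite mulr_ge0.
have h2 : 0 <= ((1 - `|r|) ^+ 2) *: f by rewrite levZ_ge0// sqr_ge0.
have h := levD h1 h2; have rE : r ^+ 2 = `|r| ^+ 2 by rewrite real_normK ?num_real.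
by rewrite rE; linle h.
Qed.

Lemma quad_min x z : (forall t : R, (2 * t) *: x - (t ^+ 2) *: f <= z) ->
  quad x <= z.
Proof.
move=> h; apply: (vsup_le ocF (x := (2 * 0) *: x - (0 ^+ 2) *: f)).
  by exists 0.
by move=> _ [t _ <-].
Qed.

Lemma quad0 : quad 0 <= 0.
Proof.
apply: quad_min => t; have h : 0 <= (t ^+ 2) *: f by rewrite levZ_ge0// sqr_ge0.
by rewrite scaler0; linle h.
Qed.

Lemma quad_parallelogram x y : modulus x <= f -> modulus y <= f ->
  quad (x + y) + quad (x - y) <= (2 : R) *: (quad x + quad y).
Proof.
move=> xf yf; set z := (2 : R) *: _.
suff h : quad (x + y) <= z - quad (x - y) by linle h.
apply: quad_min => s.
suff h : quad (x - y) <= z - ((2 * s) *: (x + y) - (s ^+ 2) *: f) by linle h.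
apply: quad_min => t.
(* These parameters work because ((s + t)^2 + (s - t)^2) / 2 = s^2 + t^2. *)
have h1 := quad_ge ((s + t) / 2) xf; have h2 := quad_ge ((s - t) / 2) yf.
by have h := levZ2l (2 : R) _ _ (ler0n _ 2) (levD h1 h2); rewrite /z; linle h.
Qed.

(** Heuristically x^2 / f <= |x| (lam f + y) / f <= lam |x| + y. For a fixed parameter t, the bound
    |x| <= f gets weight t^2 - lam if t^2 >= lam; otherwise the bound by lam f + y gets weight t^2 /
    lam. *)
Lemma quad_le x y (lam : R) : 0 < lam <= 1 -> 0 <= y -> modulus x <= f ->
  modulus x <= lam *: f + y -> quad x <= lam *: modulus x + y.
Proof.
move=> /andP[l0 l1] y0 xf xy; apply: quad_min => t.
have a0 := modulus_ge0 x.
have h1 : (2 * t) *: x <= (2 * `|t|) *: modulus x.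
  by apply: le_trans (le_modulus _) _; rewrite modulusZ normrM normr_nat.
have -> : t ^+ 2 = `|t| ^+ 2 by rewrite real_normK ?num_real.
move: `|t| h1 (normr_ge0 t) => r h1 r0.
have [lr|rl] := leP lam (r ^+ 2).
  have c1 : 0 <= r ^+ 2 - lam by rewrite subr_ge0.
  have h2 := levZ2l _ _ _ c1 xf.
  have h3 : 0 <= ((1 - r) ^+ 2) *: modulus x by rewrite levZ_ge0// sqr_ge0.
  by have h := levD (levD h1 h2) (levD h3 xy); linle h.
have c1 : 0 <= r ^+ 2 / lam by rewrite divr_ge0 ?sqr_ge0// ltW.
have h2 := levZ2l _ _ _ c1 xy.
have c2 : 0 <= 1 - r ^+ 2 / lam by rewrite subr_ge0 ler_pdivrMr// mul1r ltW.
have h3 := levZ_ge0 c2 y0.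
have h4 : 0 <= ((lam - r) ^+ 2 / lam) *: modulus x.
  by rewrite levZ_ge0// divr_ge0 ?sqr_ge0// ltW.
have h := levD (levD h1 h2) (levD h3 h4).
have ln0 : lam != 0 by rewrite gt_eqF.
linle h.
Qed.

Lemma modulus_le_quad x (t : R) : 0 < t -> modulus x <= f ->
  (2 * t) *: modulus x <= quad x + (t ^+ 2) *: f.
Proof.
move=> t0 xf; have h1 := quad_ge t xf; have h2 := quad_ge (- t) xf.
have t20 : 0 < 2 * t by rewrite mulr_gt0.
have tt : 0 <= (2 * t)^-1 by rewrite invr_ge0 ltW.
suff h : modulus x <= (2 * t)^-1 *: (quad x + (t ^+ 2) *: f).
  have := levZ2l (2 * t) _ _ (ltW t20) h.
  by rewrite scalerA divff ?gt_eqF// scale1r.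
have solve z : (2 * t) *: z <= quad x + (t ^+ 2) *: f ->
    z <= (2 * t)^-1 *: (quad x + (t ^+ 2) *: f).
  by move=> /(levZ2l _ _ _ tt); rewrite scalerA mulVf ?gt_eqF// scale1r.
rewrite modulus_le !solve//; last by linle h1.
rewrite sqrrN in h2; linle h2.
Qed.

End Quadratic.

(** * Disjoint vectors in a lattice-normed space *)

Section VectorNorm.
Context (R : realType) (V : lmodType R) (E : vectorLatticeType R).
Context (p : latticeNorm V E).
Implicit Types u v : V.

Lemma vnorm0 : p 0 = 0. Proof. exact/vnorm_eq0. Qed.

Lemma vnormN v : p (- v) = p v.
Proof. by rewrite -scaleN1r vnormZ normrN normr1 scale1r. Qed.

Lemma vnormB u v : p (u - v) <= p u + p v.
Proof. by rewrite -(vnormN v) vnormD. Qed.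

(** Meeting p u <= p (u + v) + p v with p u removes the disjoint term p v. *)
Lemma vnorm_disj_le u v : vmeet (p u) (p v) = 0 -> p u <= p (u + v).
Proof.
move=> uv; have h : p u <= p (u + v) + p v.
  by have := vnormB (u + v) v; rewrite addrK.
rewrite -[X in X <= _](vmeet_l h) vmeetC.
apply: le_trans (vmeetDl_le _ _ _) _; rewrite ?vnorm_ge0//.
by rewrite [X in _ + X]vmeetC uv addr0 vmeet_lel.
Qed.

Lemma mc_fragments_disj u v : vmeet (p u) (p v) = 0 ->
  mc_fragments p (u + v) u v.
Proof.
move=> uv; have vu : vmeet (p v) (p u) = 0 by rewrite vmeetC.
split=> //; split; first exact: vnorm_disj_le.
- by rewrite /disjoint_vec addrAC subrr add0r.
- by rewrite addrC; exact: vnorm_disj_le.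
- by rewrite /disjoint_vec addrK.
Qed.

End VectorNorm.

(** * Greedy choice of signs on a fine partition *)

Section ChoiceOfSigns.
Context (R : realType) (E F : vectorLatticeType R) (V : lmodType R).
Context (p : latticeNorm V E) (T : {linear V -> F}) (S : {linear E -> F}).
Context (ocF : order_complete F) (p_dec : decomposable p).
Context (TS : is_dominant p (modulus_norm F) T S).

Let S_mono (x y : E) : x <= y -> S x <= S y.
Proof.
by have [S0 _] := TS; rewrite -levB_ge0 => /S0; rewrite linearB levB_ge0.
Qed.

Let T_le v : modulus (T v) <= S (p v). Proof. by have [_] := TS; apply. Qed.

Lemma disj_diff_le u1 u2 : vmeet (p u1) (p u2) = 0 ->
  p (u1 - u2) <= p (u1 + u2).
Proof.
move=> u12; apply: le_trans (vnormB _ _ _) _; apply: disj_addle => //.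
  exact: vnorm_disj_le.
by rewrite addrC; apply: vnorm_disj_le; rewrite vmeetC.
Qed.

Context (phi : {scalar F}) (ophi : oc_form phi).

(* By the parallelogram inequality, adding [T u] or [- T u] to [X] increases
   the potential [phi (quad f _)] on average by at most [phi (quad f (T u))], so
   one of the two signs does. *)
Lemma choose_signs (f : F) (lam : R) d s (X : F) u : 0 <= f -> 0 < lam <= 1 ->
  part d s -> p u = d -> modulus X + S d <= f ->
  exists u1 u2, [/\ u = u1 + u2, vmeet (p u1) (p u2) = 0 &
    phi (quad f (X + T (u1 - u2))) <= phi (quad f X) +
      \sum_(c <- s) phi (lam *: S c + vpos (S c - lam *: f))].
Proof.
move=> f0 lam01 ps; have [S0 _] := TS; have /andP[l0 _] := lam01.
elim: ps X u => [e e0|a b s1 s2 ab pa IHa pb IHb] X u pu Xf.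
  rewrite big_seq1; set B := phi (lam *: _ + _); have Se0 := S0 _ e0.
  have Tu : modulus (T u) <= S e by rewrite -pu.
  have Xf' : modulus X <= f by apply: le_trans Xf; exact: lev_addr.
  have Tuf : modulus (T u) <= f.
    by apply: le_trans Tu _; apply: le_trans Xf; exact/lev_addl/modulus_ge0.
  have QB : phi (quad f (T u)) <= B.
    have e1 := vpos_ge0 (S e - lam *: f).
    apply: oc_form_mono => //; apply: le_trans (quad_le ocF lam01 e1 Tuf _) _.
      by apply: le_trans Tu _; have h := le_vpos (S e - lam *: f); linle h.
    by have h := levZ2l _ _ _ (ltW l0) Tu; linle h.
  have := oc_form_mono ophi (quad_parallelogram ocF f0 Xf' Tuf).
  rewrite linearD linearZ linearD /= => hpar.
  have [h|h] := leP (phi (quad f (X + T u))) (phi (quad f X) + B).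
    exists u, 0; rewrite addr0 subr0 vnorm0; split=> //.
    by rewrite vmeetC vmeet_l// vnorm_ge0.
  exists 0, u; rewrite add0r sub0r vnorm0 linearN; split=> //; last by lra.
  by rewrite vmeet_l// vnorm_ge0.
(* Signs on [a] come first, and those on [b] start from [X + T (ua1 - ua2)]. This step costs at most
   S a, so the new start still satisfies the bound by f with S b left over. *)
have a0 := part_ge0 pa; have b0 := part_ge0 pb.
have [ua [ub [uE pua pub]]] := p_dec a0 b0 pu.
have Sab := S_mono (lev_addr a b0); rewrite !linearD in Xf Sab.
have Sb0 := S0 _ b0.
have [|ua1 [ua2 [uaE da ha]]] := IHa X ua pua.
  by have h := levD Xf Sb0; linle h.
have Ta : modulus (T (ua1 - ua2)) <= S a.
  by apply: le_trans (T_le _) _; apply: S_mono; rewrite -pua uaE disj_diff_le.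
have [|ub1 [ub2 [ubE db hb]]] := IHb (X + T (ua1 - ua2)) ub pub.
  by have h := levD (modulusD X (T (ua1 - ua2))) (levD Xf Ta); linle h.
have da' : vmeet (p ua2) (p ua1) = 0 by rewrite vmeetC.
have db' : vmeet (p ub2) (p ub1) = 0 by rewrite vmeetC.
have a1 : p ua1 <= a by rewrite -pua uaE vnorm_disj_le.
have a2 : p ua2 <= a by rewrite -pua uaE addrC vnorm_disj_le.
have b1 : p ub1 <= b by rewrite -pub ubE vnorm_disj_le.
have b2 : p ub2 <= b by rewrite -pub ubE addrC vnorm_disj_le.
have dab x y : p x <= a -> p y <= b -> vmeet (p x) (p y) = 0.
  by move=> xa yb; apply: disj_le ab; rewrite ?vnorm_ge0.
exists (ua1 + ub1), (ua2 + ub2); split.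
- by rewrite uE uaE ubE addrACA.
- apply: (@disj_le _ _ _ (p ua1 + p ub1) _ (p ua2 + p ub2));
    rewrite ?vnorm_ge0 ?vnormD//.
  have n0 v : 0 <= p v := vnorm_ge0 p v.
  apply: disjD; rewrite ?levD_ge0//; rewrite vmeetC; apply: disjD => //.
    by rewrite vmeetC; exact: dab.
  exact: dab.
- rewrite big_cat /= opprD addrACA linearD addrA.
  by apply: le_trans hb _; rewrite addrA lerD2r.
Qed.

Lemma diffuse_signs u (eps : R) : diffuse S -> 0 < eps ->
  exists u1 u2, [/\ u = u1 + u2, vmeet (p u1) (p u2) = 0 &
    phi (modulus (T (u1 - u2))) < eps].
Proof.
move=> dS e0; have [S0 _] := TS; set f := S (p u).
have f0 : 0 <= f by exact/S0/vnorm_ge0.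
have M0 := oc_form_ge0 ophi f0; set M := phi f in M0.
have M1 : 0 < M + 1 by rewrite ltr_wpDl.
(* The final estimate bounds 2 t phi |T (u1 - u2)| by M / m + m phi g + t^2 M. The choice of t makes
   the last term less than t eps; m = 2^n and the bound on phi g make each of the others less than t
   eps / 2. *)
set t := eps / (M + 1); have t0 : 0 < t by rewrite divr_gt0.
have tM : t * M < eps by rewrite /t mulrAC ltr_pdivrMr// ltr_pM2l// ltrDl.
have [n nM] : exists n, M / (eps * t) * 2 < (2 ^ n)%:R.
  have z0 : 0 <= M / (eps * t) * 2.
    by rewrite mulr_ge0// divr_ge0// ltW// mulr_gt0.
  have /andP[_ hm] := truncn_itv z0; exists (Num.truncn (M / (eps * t) * 2)).+1.
  by apply: lt_le_trans hm _; rewrite ler_nat ltnW// ltn_expl.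
set m := (2 ^ n)%N in nM; have m0 : (0 < m)%N by rewrite expn_gt0.
have mR0 : (0 : R) < m%:R by rewrite ltr0n.
have e1 : 0 < eps * t / 2 / m%:R by rewrite divr_gt0// divr_gt0// mulr_gt0.
have [s [g [ps g0 gs hs]]] := diffuse_iter dS n ophi (vnorm_ge0 p u) e1.
have lam01 : 0 < (m%:R^-1 : R) <= 1.
  by rewrite invr_gt0 mR0 invf_le1// ler1n.
have h0 : modulus 0 + S (p u) <= f by rewrite modulus_id// add0r.
have [u1 [u2 [uE u12]]] := choose_signs f0 lam01 ps erefl h0.
rewrite add0r => hq; exists u1, u2; split=> //.
have Tf : modulus (T (u1 - u2)) <= f.
  by apply: le_trans (T_le _) _; apply: S_mono; rewrite uE disj_diff_le.
have sumS : \sum_(c <- s) S c <= f.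
  by apply: part_superadd ps (lexx _) _ => a b _ _ _ _; rewrite linearD.
have exc : \sum_(c <- s) vpos (S c - (m%:R^-1 : R) *: f) <= g *+ m.
  apply: sum_excess_le => // c /(part_mem ps)/andP[c0 _]; exact: S0.
have sum_le : \sum_(c <- s) phi ((m%:R^-1 : R) *: S c +
    vpos (S c - (m%:R^-1 : R) *: f)) <= m%:R^-1 * M + m%:R * phi g.
  have -> : m%:R^-1 * M + m%:R * phi g = phi ((m%:R^-1 : R) *: f + g *+ m).
    by rewrite linearD linearZ raddfMn /= mulr_natl.
  rewrite -raddf_sum big_split /= -scaler_sumr; apply: oc_form_mono => //; apply: levD exc.
  by apply: levZ2l => //; rewrite invr_ge0 ltW.
have q0 : phi (quad f 0) <= 0.
  by rewrite -[X in _ <= X](linear0 phi); apply: oc_form_mono => //; exact: quad0.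
have := oc_form_mono ophi (modulus_le_quad ocF f0 t0 Tf).
rewrite [phi (_ + _)]linearD ![phi (_ *: _)]linearZ /= -/M => hmod.
have a1 : t ^+ 2 * M < t * eps by rewrite expr2 -mulrA ltr_pM2l.
have a2 : m%:R^-1 * M < t * eps / 2.
  rewrite mulrC ltr_pdivrMr//.
  have et0 : 0 < eps * t by rewrite mulr_gt0.
  by move: nM; rewrite mulrAC ltr_pdivrMr//; lra.
have a3 : m%:R * phi g < t * eps / 2.
  by move: gs; rewrite ltr_pdivlMr//; lra.
have t20 : 0 < 2 * t by rewrite mulr_gt0.
rewrite -(ltr_pM2l t20).
have : phi (quad f (T (u1 - u2))) <= m%:R^-1 * M + m%:R * phi g by lra.
lra.
Qed.

End ChoiceOfSigns.

(** * From smallness under strictly positive forms to order convergence *)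

Section NullSequence.
Context (R : realType) (F : vectorLatticeType R) (ocF : order_complete F).
Context (f : F) (phi : nat -> {scalar F}) (phi_oc : forall n, oc_form (phi n)).
Context (phi_mono : forall m n x, (m <= n)%N -> 0 <= x -> phi m x <= phi n x).
Context (phi_pos : forall x, 0 <= x <= f -> (forall n, phi n x = 0) -> x = 0).
Context (x : nat -> F) (x_ge0 : forall n, 0 <= x n) (x_le : forall n, x n <= f).
Context (x_small : forall n, phi n (x n) < 2^-1 ^+ n).

(** Left transparent so that its carrier and order reduce to those of [nat]. *)
Definition nat_directed : directedSet.
Proof.
refine (@DirectedSet nat (fun m n => (m <= n)%N) 0%N leqnn _ _).
- by move=> a b c; exact: leq_trans.
- by move=> a b; exists (maxn a b); rewrite leq_maxl leq_maxr.
Defined.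

Definition tail_sup n : F := vsup [set x k | k in [set k | (n <= k)%N]].

Lemma tail_sup_ge n k : (n <= k)%N -> x k <= tail_sup n.
Proof.
move=> nk; apply: (vsup_ge ocF (m := f)); last by exists k.
by move=> _ [j _ <-].
Qed.

Lemma tail_sup_le n z : (forall k, (n <= k)%N -> x k <= z) -> tail_sup n <= z.
Proof.
move=> h; apply: (vsup_le ocF (x := x n)); first by exists n => /=.
by move=> _ [k nk <-]; exact: h.
Qed.

Let partial_sup n := fix partial_sup i : F :=
  if i is j.+1 then vjoin (partial_sup j) (x (n + i)) else x n.

Let partial_sup_le n i : partial_sup n i <= tail_sup n.
Proof.
elim: i => [|i IH] /=; first exact: tail_sup_ge.
by rewrite vjoin_le IH tail_sup_ge// leq_addr.
Qed.

Let partial_sup_ge n i : x (n + i) <= partial_sup n i.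
Proof. by case: i => [|i] /=; [rewrite addn0|exact: le_vjoinr]. Qed.

Let partial_sup_mono n i j : (i <= j)%N -> partial_sup n i <= partial_sup n j.
Proof.
elim: j => [|j IH]; first by rewrite leqn0 => /eqP ->.
rewrite leq_eqVlt => /predU1P[->//|]; rewrite ltnS => /IH h.
exact: le_trans h (le_vjoinl _ _).
Qed.

(** A join of positive elements is below their sum, and the right side is the geometric sum from
    2^-n to 2^-(n+i). *)
Let phi_partial_sup k n i : (k <= n)%N ->
  phi k (partial_sup n i) <= 2 * 2^-1 ^+ n - 2^-1 ^+ (n + i).
Proof.
move=> kn; have small j : phi k (x (n + j)) <= 2^-1 ^+ (n + j).
  apply: le_trans (ltW (x_small (n + j))); apply: phi_mono => //.
  exact: leq_trans kn (leq_addr _ _).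
elim: i => [|i IH].
  have := small 0%N; rewrite addn0 /=; lra.
have ps0 j : 0 <= partial_sup n j by exact: le_trans (partial_sup_ge n j).
have h : partial_sup n i.+1 <= partial_sup n i + x (n + i.+1).
  by rewrite vjoin_le lev_addr// lev_addl.
have := oc_form_mono (phi_oc k) h; have := small i.+1.
by rewrite linearD addnS exprS /=; lra.
Qed.

Let phi_tail_sup k n : (k <= n)%N -> phi k (tail_sup n) <= 2 * 2^-1 ^+ n.
Proof.
move=> kn; apply/ler_addgt0Pr => eps e0.
have [||_ [i _ <-] hi] := oc_form_vanishing (phi_oc k)
    (A := [set tail_sup n - partial_sup n i | i in setT]) _ _ e0.
- split; first by exists (tail_sup n - partial_sup n 0), 0%N.
  move=> _ _ [i _ <-] [j _ <-]; exists (tail_sup n - partial_sup n (maxn i j)).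
  have hi := partial_sup_mono n (leq_maxl i j).
  have hj := partial_sup_mono n (leq_maxr i j).
  by split; [exists (maxn i j)|linle hi|linle hj].
- split=> [_ [i _ <-]|y hy]; first by rewrite levB_ge0.
  suff h : tail_sup n <= tail_sup n - y by linle h.
  apply: tail_sup_le => k' nk'; rewrite -(subnKC nk').
  apply: le_trans (partial_sup_ge _ _) _.
  have h : y <= tail_sup n - partial_sup n (k' - n).
    by apply: hy; exists (k' - n)%N.
  by linle h.
have := phi_partial_sup i kn; move: hi; rewrite linearB /=.
have : (0 : R) <= 2^-1 ^+ (n + i) by rewrite exprn_ge0// invr_ge0.
lra.
Qed.

(** The positive part of a lower bound is below every tail supremum. Evaluating [phi k] at the tails
    of index k + n shows that every form kills it, so it is 0 by strict positivity. *)
Lemma tail_sup_decreasing : @decreasing_to0 R F nat_directed tail_sup.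
Proof.
split=> [a b /= ab|].
  by apply: tail_sup_le => k bk; apply: tail_sup_ge; exact: leq_trans bk.
split=> [_ [n _ <-]|y hy]; first exact: le_trans (tail_sup_ge (leqnn n)).
have vy n : vpos y <= tail_sup n.
  rewrite vpos_le (le_trans (x_ge0 n) (tail_sup_ge (leqnn n))) andbT.
  by apply: hy; exists n.
apply: le_trans (le_vpos y) _; suff -> : vpos y = 0 by [].
apply: phi_pos => [|k].
  by rewrite vpos_ge0 (le_trans (vy 0%N))// tail_sup_le.
apply/le_anti/andP; split; last by apply: oc_form_ge0 => //; exact: vpos_ge0.
apply/ler_addgt0Pl => eps e0; rewrite addr0.
have [n hn] : exists n, 2 * 2^-1 ^+ (k + n) < eps.
  have [m] := ltr_add_invr e0; rewrite add0r => hm.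
  exists m.+1; rewrite addnS exprS mulrA mulfV// mul1r.
  apply: le_lt_trans hm; rewrite exprVn lef_pV2 ?posrE ?exprn_gt0//.
  rewrite -natrX ler_nat; apply: leq_trans (ltn_expl _ (isT : (1 < 2)%N)) _.
  by rewrite leq_exp2l ?leq_addl.
apply: le_trans (ltW hn); apply: le_trans (phi_tail_sup (leq_addr n k)).
exact: oc_form_mono.
Qed.

End NullSequence.

(** * Diffuse dominants give order narrow operators *)

Section DiffuseToNarrow.
Context (R : realType) (E F : vectorLatticeType R) (V : lmodType R).
Context (p : latticeNorm V E) (T : {linear V -> F}) (S : {linear E -> F}).

(** A sequence suffices as net: its n-th splitting is chosen for the n-th form with error 2^-n, and
    the tail suprema dominate. *)
Lemma diffuse_order_narrow : order_complete F ->
  ideal_of_oc_banach_lattice F -> decomposable p ->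
  is_dominant p (modulus_norm F) T S -> diffuse S ->
  order_narrow p (modulus_norm F) T.
Proof.
move=> ocF /ideal_oc_norm[N N_oc] p_dec TS dS u.
have [S0 T_le] := TS; set f := S (p u).
have f0 : 0 <= f by exact/S0/vnorm_ge0.
have [phi [phi_oc phi_mono phi_pos]] := strictly_positive_forms N_oc ocF f0.
have e0 n : (0 : R) < 2^-1 ^+ n by rewrite exprn_gt0// invr_gt0.
have choice_v n : {w : V * V | [/\ u = w.1 + w.2, vmeet (p w.1) (p w.2) = 0 &
    phi n (modulus (T (w.1 - w.2))) < 2^-1 ^+ n]}.
  apply: cid.
  have [u1 [u2 h]] := diffuse_signs ocF p_dec TS (phi_oc n) u dS (e0 n).
  by exists (u1, u2).
pose w n := sval (choice_v n); pose v n := (w n).1 - (w n).2.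
pose x n := modulus (T (v n)).
have x0 n : 0 <= x n by exact: modulus_ge0.
have xf n : x n <= f.
  have [uE w12 _] := svalP (choice_v n); apply: le_trans (T_le _) _.
  by rewrite /f -levB_ge0 -linearB S0// levB_ge0 [in leRHS]uE disj_diff_le.
have xs n : phi n (x n) < 2^-1 ^+ n by have [] := svalP (choice_v n).
exists nat_directed, v; split=> [n|].
  have [uE w12 _] := svalP (choice_v n).
  by exists (w n).1, (w n).2; split=> //; rewrite uE; exact: mc_fragments_disj.
exists nat_directed, (tail_sup x); split.
  exact: (tail_sup_decreasing ocF phi_oc phi_mono phi_pos x0 xf xs).
move=> n; exists n => k nk; rewrite sub0r /= modulusN.
exact: (tail_sup_ge ocF xf nk).
Qed.

End DiffuseToNarrow.

(** * A vector lattice as a lattice-normed space over itself *)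

Section ModulusNorm.
Context (R : realType) (E F : vectorLatticeType R).

(** Cut e1 into a = x^+ /\ e1 and b = e1 - a; since e1 <= x^+ + x^-, b fits below x^-. Then x1 = a -
    b, and the disjointness of x^+ and x^- makes the moduli add up. *)
Lemma modulus_norm_decomposable : decomposable (modulus_norm E).
Proof.
move=> x e1 e2 e10 e20 /= xE; rewrite modulusE in xE.
have P0 := vpos_ge0 x; have N0 := vpos_ge0 (- x).
set P := vpos x in xE P0 *; set N := vpos (- x) in xE N0 *.
pose a := vmeet P e1; pose b := e1 - a.
have a0 : 0 <= a by exact: vmeet_ge0.
have b0 : 0 <= b by rewrite levB_ge0 vmeet_ler.
have aP : a <= P := vmeet_lel _ _.
have bN : b <= N.
  suff h : e1 - N <= a by rewrite /b; linle h.
  rewrite le_vmeet; apply/andP; split; last by linle N0.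
  have h : e1 <= P + N by rewrite xE lev_addr.
  by linle h.
have disj_sub (c d : E) : 0 <= c -> 0 <= d -> c <= P -> d <= N ->
    modulus (c - d) = c + d.
  move=> c0 d0 cP dN; have cd : vmeet c d = 0.
    by apply: disj_le (vpos_disj x).
  have cd' : vmeet (modulus c) (modulus (- d)) = 0.
    by rewrite modulusN !modulus_id.
  have dc' : vmeet (modulus (- d)) (modulus c) = 0 by rewrite vmeetC.
  apply/le_anti/andP; split.
    have := vnormB (modulus_norm E) c d.
    by rewrite /= (modulus_id c0) (modulus_id d0).
  apply: disj_addle => //.
    have := vnorm_disj_le (p := modulus_norm E) cd'.
    by rewrite /= (modulus_id c0).
  have := vnorm_disj_le (p := modulus_norm E) dc'.
  by rewrite /= modulusN addrC (modulus_id d0).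
exists (a - b), ((P - a) - (N - b)); split.
- by rewrite -[LHS](vposB x); lineq.
- by rewrite disj_sub// /b; lineq.
- rewrite disj_sub ?levB_ge0//.
  + transitivity (P + N - e1); first by rewrite /b; lineq.
    by rewrite xE; lineq.
  + by linle a0.
  + by linle b0.
Qed.

Lemma positive_exact_dominant (S : {linear E -> F}) : positive_operator S ->
  is_exact_dominant (modulus_norm E) (modulus_norm F) S S.
Proof.
move=> S0; split=> [|S' [_ h] e e0].
  split=> // v /=; rewrite modulus_le; apply/andP; split.
    by rewrite -levB_ge0 -linearB S0// levB_ge0 le_modulus.
  have k : 0 <= modulus v + v by have h := leN_modulus v; linle h.
  by have := S0 _ k; rewrite linearD => h; linle h.
rewrite levB_ge0; apply: le_trans (le_modulus _) _.
by have := h e; rewrite /= (modulus_id e0).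
Qed.

End ModulusNorm.

Theorem theorem5p1 (R : realType) (E F : vectorLatticeType R)
    (V : lmodType R) (p : latticeNorm V E)
    (T : {linear V -> F}) (TT : {linear E -> F}) :
  order_complete E -> order_complete F ->
  atomless E ->
  ideal_of_oc_banach_lattice F ->
  banach_kantorovich p ->
  bo_continuous p (modulus_norm F) T ->
  dominated p (modulus_norm F) T ->
  is_exact_dominant p (modulus_norm F) T TT ->
  (order_narrow p (modulus_norm F) T <->
   order_narrow (modulus_norm E) (modulus_norm F) TT).
Proof.
move=> ocE ocF _ idF [p_dec _] _ _ domTT.
(* [TT] is the exact dominant of both [T] and itself, so each direction passes through diffuseness
   of [TT]. *)
have [[TT0 _] _] := domTT; have domE := positive_exact_dominant TT0.
split=> [nT|nTT].
  have dTT := order_narrow_diffuse ocE ocF nT domTT.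
  exact: diffuse_order_narrow ocF idF (@modulus_norm_decomposable _ E) domE.1 dTT.
have dTT := order_narrow_diffuse ocE ocF nTT domE.
exact: diffuse_order_narrow ocF idF p_dec domTT.1 dTT.
Qed.
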